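(* Let $B_n$ be the braid group endowed with the dual Garside structure. Let $n=rd+1$ for integers $r\geqslant 2$ and $d\geqslant 1$, and let $\varepsilon=\delta a_{21}$. Let $\alpha$ be a 1-pure braid in the super summit set of $\varepsilon^d$ in $B_n$. If $d=1$, then $\alpha=\varepsilon$. If $d\geqslant 2$, then $\alpha=\delta^d a$ for a simple element $a$ of the form $a=a_{d+1,1}b_0 b_1 \cdots b_{r-1}$, where (1) each $b_k$ is a simple element supported on $kd+\{2,3,\ldots,d+1\}=\{kd+2,\ldots,kd+d+1\}$ for $0\leqslant k\leqslant r-1$, and (2) $b_0\, \tau^{-d}(b_1)\,\tau^{-2d}(b_2)\cdots\tau^{-(r-1)d}(b_{r-1})=[d+1,\ldots,3,2]$. In this case, $c^{-1}\alpha c=\varepsilon^d$ for the simple element $$c=\tau^{-d}(b_1b_2\cdots b_{r-1})\,\tau^{-2d}(b_2b_3\cdots b_{r-1})\cdots\tau^{-(r-1)d}(b_{r-1}).$$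
   Context: $B_n$ has the Birman–Ko–Lee presentation with band generators $a_{ij}$, $1\leqslant j<i\leqslant n$, where $a_{ij}=\sigma_{i-1}\cdots\sigma_{j+1}\sigma_j\sigma_{j+1}^{-1}\cdots\sigma_{i-1}^{-1}$ in terms of Artin generators, and $a_{ji}:=a_{ij}$. The dual Garside structure is $(B_n,B_n^+,\delta)$ where $B_n^+$ is the monoid of elements represented by positive words in the band generators and $\delta=a_{n,n-1}a_{n-1,n-2}\cdots a_{21}=\sigma_{n-1}\cdots\sigma_1$. The partial order: $\alpha\preccurlyeq\beta$ iff $\alpha^{-1}\beta\in B_n^+$. Simple elements are the $\alpha$ with $1\preccurlyeq\alpha\preccurlyeq\delta$. For $\alpha\in B_n$, $\inf(\alpha)=\max\{r:\delta^r\preccurlyeq\alpha\}$, $\sup(\alpha)=\min\{s:\alpha\preccurlyeq\delta^s\}$, $\operatorname{len}(\alpha)=\sup(\alpha)-\inf(\alpha)$; the super summit set $[\alpha]^S$ is the set of conjugates $\beta$ of $\alpha$ with $\operatorname{len}(\beta)$ minimal among all conjugates. $\tau(\alpha)=\delta^{-1}\alpha\delta$; one has $\tau(a_{ij})=a_{i+1,j+1}$ with indices mod $n$. For $1\leqslant i_1<\cdots<i_k\leqslant n$, $[i_k,\ldots,i_1]$ denotes $a_{i_ki_{k-1}}\cdots a_{i_3i_2}a_{i_2i_1}$ (a subsimple with support $\{i_1,\ldots,i_k\}$ when $k\ge2$; the identity when $k=1$). Every simple element is uniquely (up to order of commuting factors) a product $b_{T_1}\cdots b_{T_m}$ of subsimples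 over the blocks of a noncrossing partition $\{T_1,\dots,T_m\}$ of $\{1,\ldots,n\}$; a simple element is supported on $S$ if every nonidentity subsimple factor has support contained in $S$. A braid $\alpha$ is 1-pure if its induced permutation fixes $1$. *)

(* Defs.v *)
(* Braids in B_n are represented by words in the Artin
   generators sigma_i^{+-1} (1 <= i <= n-1), modulo the equivalence relation
   [beq n] generated by the defining relations of B_n (free cancellation,
   far commutation, braid relation).  Equality of braids is [beq n]. *)
From mathcomp Require Import all_boot all_algebra.
Set Implicit Arguments. Unset Strict Implicit. Unset Printing Implicit Defensive.

(* a letter (i, true) is sigma_i, (i, false) is sigma_i^{-1} *)
Definition letter := (nat * bool)%type.
Definition word := seq letter.

Definition valid (n : nat) (w : word) : bool := all (fun l => (0 < l.1 < n)%N) w.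

Inductive elem_rel (n : nat) : word -> word -> Prop :=
| er_free i b : (0 < i < n)%N -> elem_rel n [:: (i, b); (i, ~~ b)] [::]
| er_comm i j b c : (0 < i < n)%N -> (0 < j < n)%N -> ((i.+1 < j) || (j.+1 < i))%N ->
    elem_rel n [:: (i, b); (j, c)] [:: (j, c); (i, b)]
| er_braid i : (0 < i)%N -> (i.+1 < n)%N ->
    elem_rel n [:: (i, true); (i.+1, true); (i, true)]
               [:: (i.+1, true); (i, true); (i.+1, true)].

Inductive beq (n : nat) : word -> word -> Prop :=
| beq_step u v l r : elem_rel n l r -> beq n (u ++ l ++ v) (u ++ r ++ v)
| beq_refl w : beq n w w
| beq_sym w1 w2 : beq n w1 w2 -> beq n w2 w1
| beq_trans w1 w2 w3 : beq n w1 w2 -> beq n w2 w3 -> beq n w1 w3.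

Definition winv (w : word) : word := rev [seq (l.1, ~~ l.2) | l <- w].

Definition wpow (w : word) (k : int) : word :=
  match k with
  | Posz m => flatten (nseq m w)
  | Negz m => flatten (nseq m.+1 (winv w))
  end.

Definition band_aux (i j : nat) : word :=
  [seq (k, true) | k <- rev (iota j.+1 (i - j.+1))] ++ [:: (j, true)] ++
  [seq (k, false) | k <- iota j.+1 (i - j.+1)].
Definition band (i j : nat) : word := if (j < i)%N then band_aux i j else band_aux j i.

Definition delta (n : nat) : word := [seq (k, true) | k <- rev (iota 1 n.-1)].

Definition epsilon (n : nat) : word := delta n ++ band 2 1.

Definition pos (n : nat) (w : word) : Prop :=
  exists s : seq (nat * nat),
    all (fun p => (1 <= p.2)%N && (p.2 < p.1)%N && (p.1 <= n)%N) s /\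
    beq n w (flatten [seq band p.1 p.2 | p <- s]).

Definition prec (n : nat) (a b : word) : Prop := pos n (winv a ++ b).

Definition simple (n : nat) (a : word) : Prop := prec n [::] a /\ prec n a (delta n).

Definition is_inf (n : nat) (w : word) (r : int) : Prop :=
  prec n (wpow (delta n) r) w /\
  forall r' : int, prec n (wpow (delta n) r') w -> (r' <= r)%R.

Definition is_sup (n : nat) (w : word) (s : int) : Prop :=
  prec n w (wpow (delta n) s) /\
  forall s' : int, prec n w (wpow (delta n) s') -> (s <= s')%R.

Definition len_is (n : nat) (w : word) (l : int) : Prop :=
  exists r s : int, is_inf n w r /\ is_sup n w s /\ l = (s - r)%R.

Definition conjugate (n : nat) (alpha beta : word) : Prop :=
  exists c : word, valid n c /\ beq n (winv c ++ alpha ++ c) beta.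

Definition in_SSS (n : nat) (alpha beta : word) : Prop :=
  valid n beta /\ conjugate n alpha beta /\
  exists l : int, len_is n beta l /\
    forall (g : word) (l' : int), valid n g -> conjugate n alpha g ->
      len_is n g l' -> (l <= l')%R.

Definition tau (n : nat) (k : int) (w : word) : word :=
  wpow (delta n) (- k)%R ++ w ++ wpow (delta n) k.

(* [i_k, ..., i_1] = a_{i_k i_{k-1}} ... a_{i_2 i_1} for s = [:: i_1; ...; i_k] *)
Definition subsimple (s : seq nat) : word :=
  flatten [seq band p.2 p.1 | p <- rev (zip s (behead s))].

Definition crossfree (T U : seq nat) : bool :=
  all (fun a => all (fun c => all (fun b => all (fun e =>
    ~~ ((a < b) && (b < c) && (c < e))%N) U) U) T) T.

Definition noncrossing_disjoint (T U : seq nat) : bool :=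
  ~~ has (fun x => x \in U) T && crossfree T U && crossfree U T.

(* b is a simple element supported on S: b is a product of subsimples over
   the blocks of a noncrossing partition of {1..n} (the singleton blocks
   giving identity factors are left implicit), all of whose nonidentity
   factors have support contained in S. *)
Definition supported_on (n : nat) (S : seq nat) (b : word) : Prop :=
  simple n b /\
  exists P : seq (seq nat),
    all (fun T => sorted ltn T && (2 <= size T)%N &&
                  all (fun x => (1 <= x <= n)%N && (x \in S)) T) P /\
    pairwise noncrossing_disjoint P /\
    beq n b (flatten [seq subsimple T | T <- P]).

Definition swap_pt (i x : nat) : nat :=
  if x == i then i.+1 else if x == i.+1 then i else x.
Definition perm_img (w : word) (x : nat) : nat :=
  foldl (fun y l => swap_pt l.1 y) x w.

Definition one_pure (w : word) : Prop := perm_img w 1 = 1%N.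

(* Main.v *)
(* The exponent sum shows that a super summit element has the form
   delta^d a with a simple of length d.  Everything about simple elements is
   read off in the symmetric group: by peeling transpositions off a noncrossing
   partition, any two band words of length n-1 whose permutation is that of
   delta represent delta, so the factors of such words are determined by their
   permutations.

   Let u be the permutation of delta^d a_{d+1,1}.  It fixes 1 and rotates the r
   blocks {kd+2, ..., kd+d+1}.  As alpha is 1-pure, a = a_{d+1,1} b, and since
   epsilon^{n-1} is central, (u b)^r = (u D)^r = 1 for D = [d+1, ..., 2].
   Expanding both powers gives b^{u^{r-1}} ... b^u b = D^{u^{r-1}} ... D^u D, a
   factorization of the product over all the blocks with right factor b; hence b
   splits as b_0 ... b_{r-1} along the blocks.  Commuting distinct blocks past
   each other gives c^{-1} alpha c = delta^d a_{d+1,1} E with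
   E = b_0 tau^{-d}(b_1) ... supported on the block of 2.  Therefore (u E)^r = 1
   too, which forces E = D. *)
Require Import Defs.
From HB Require Import structures.
From mathcomp Require Import all_boot all_order all_algebra all_fingroup zify.
From mathcomp.classical Require Import boolp.
Set Implicit Arguments. Unset Strict Implicit. Unset Printing Implicit Defensive.

(** Cycle counting takes the place of a normal form. A product of [k] transpositions of [n+1] points
    has at least [n+1-k] cycles, and the word of a noncrossing partition attains this bound. So in
    any other word of the same length and permutation the first letter joins two points of one
    cycle, hence of one block, and the triangular relations pull that letter out of the block
    ([split_block]). Once words of minimal length are determined by their permutations, they can be
    rearranged in the symmetric group, where a conjugate of a letter is again a letter. The lengths
    must therefore balance exactly. Since [r >= 2], [d < n-1], so the exponent [dn] lies strictly
    between [d(n-1)] and [(d+1)(n-1)]; this fixes inf and sup. The product over the blocks has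
    length [r(d-1)], and [r] conjugates of [a_{d+1,1}] bring it to [rd = n-1], the length of
    [delta]. The same balance makes [c] simple: [b_0 ... b_{r-1} c] is a right factor of the product
    over the blocks, hence of [delta]. *)

(** * The braid group as a quotient of words *)

Lemma beq_cat n u u' v v' : beq n u u' -> beq n v v' -> beq n (u ++ v) (u' ++ v').
Proof.
move=> Hu Hv; apply: (@beq_trans _ _ (u' ++ v)).
  elim: Hu => [x y l r lr|w|w1 w2 _|w1 w2 w3 _ + _].
  - by rewrite -!catA; exact: beq_step.
  - exact: beq_refl.
  - exact: beq_sym.
  - exact: beq_trans.
elim: Hv => [x y l r lr|w|w1 w2 _|w1 w2 w3 _ + _].
- by rewrite !catA -!(catA (u' ++ x)); exact: beq_step.
- exact: beq_refl.
- exact: beq_sym.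
- exact: beq_trans.
Qed.

Lemma elem_rel_beq n l r : elem_rel n l r -> beq n l r.
Proof. by move=> lr; move: (@beq_step n [::] [::] l r lr); rewrite /= !cats0. Qed.

Lemma winv_cons l w : winv (l :: w) = winv w ++ [:: (l.1, ~~ l.2)].
Proof. by rewrite /winv /= rev_cons cats1. Qed.

Lemma valid_cat n u v : valid n (u ++ v) = valid n u && valid n v.
Proof. exact: all_cat. Qed.

Lemma valid_winv n w : valid n (winv w) = valid n w.
Proof. by rewrite /valid /winv all_rev all_map; apply: eq_all. Qed.

Lemma valid_flatten n ws : valid n (flatten ws) = all (valid n) ws.
Proof. by elim: ws => //= w ws <-; rewrite valid_cat. Qed.

Lemma beq_mulV n w : valid n w -> beq n (w ++ winv w) [::].
Proof.
elim: w => [|[i b] w IH] /=; first by move=> _; exact: beq_refl.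
case/andP=> hi hw; rewrite winv_cons /=.
apply: (@beq_trans _ _ ([:: (i, b)] ++ [::] ++ [:: (i, ~~ b)])).
  rewrite -[_ :: w ++ _]/([:: (i, b)] ++ (w ++ _)) catA.
  apply: beq_cat; first exact: beq_refl.
  by rewrite -[X in beq n _ X]cat0s; apply: beq_cat; [exact: IH | exact: beq_refl].
exact/elem_rel_beq/er_free.
Qed.

Definition clean n (w : word) : word := [seq l <- w | 0 < l.1 < n].

Lemma clean_valid n w : valid n w -> clean n w = w.
Proof. by move=> h; apply/all_filterP. Qed.

Lemma valid_clean n w : valid n (clean n w).
Proof. exact: filter_all. Qed.

Lemma clean_cat n u v : clean n (u ++ v) = clean n u ++ clean n v.
Proof. exact: filter_cat. Qed.

Lemma clean_winv n w : clean n (winv w) = winv (clean n w).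
Proof.
by rewrite /clean /winv filter_rev filter_map.
Qed.

(* Letters outside the range 1..n-1 have no inverse modulo [beq n]; they are
   discarded so that every word has a class in the group. *)
Definition ceq n : rel word := fun u v => `[< beq n (clean n u) (clean n v) >].

Lemma ceq_refl n : reflexive (ceq n).
Proof. by move=> w; apply/asboolP; exact: beq_refl. Qed.

Lemma ceq_sym n : symmetric (ceq n).
Proof. by move=> u v; apply/asboolP/asboolP => h; exact: beq_sym. Qed.

Lemma ceq_trans n : transitive (ceq n).
Proof.
by move=> v u w /asboolP uv /asboolP vw; apply/asboolP; exact: beq_trans uv vw.
Qed.

Canonical ceq_equiv n := EquivRel (ceq n) (@ceq_refl n) (@ceq_sym n) (@ceq_trans n).

Definition braid n := {eq_quot (ceq_equiv n)}%qT.
HB.instance Definition _ n := Choice.on (braid n).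
HB.instance Definition _ n := EqQuotient.on (braid n).

Definition cls n (w : word) : braid n := (\pi_(braid n) w)%qT.

Lemma clsP n u v : reflect (cls n u = cls n v) (ceq n u v).
Proof.
apply: (iffP idP) => [h|h].
  by apply/eqP; rewrite /cls eqmodE.
by move/eqP: h; rewrite /cls eqmodE.
Qed.

Lemma cls_beq n u v : valid n u -> valid n v -> cls n u = cls n v <-> beq n u v.
Proof.
move=> hu hv; split; first by move/clsP/asboolP; rewrite !clean_valid.
by move=> h; apply/clsP/asboolP; rewrite !clean_valid.
Qed.

Lemma clean_elem n l r : elem_rel n l r -> elem_rel n (clean n l) (clean n r).
Proof.
by case=> *; rewrite /clean /=; repeat (case: ifP => [_|]; last lia); constructor; lia.
Qed.

Lemma beq_cls n u v : beq n u v -> cls n u = cls n v.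
Proof.
move=> h; apply/clsP/asboolP.
elim: h => {u v} [u v l r lr|w|w1 w2 _|w1 w2 w3 _ + _].
- by rewrite !clean_cat; apply/beq_step/clean_elem.
- exact: beq_refl.
- exact: beq_sym.
- exact: beq_trans.
Qed.

Lemma cls_repr n (x : braid n) : cls n (generic_quotient.repr x) = x.
Proof. exact: reprK. Qed.

HB.lock Definition bmul n (x y : braid n) := cls n (generic_quotient.repr x ++ generic_quotient.repr y).
Definition binv n (x : braid n) := cls n (winv (generic_quotient.repr x)).

Lemma bmulE n u v : bmul (cls n u) (cls n v) = cls n (u ++ v).
Proof.
rewrite bmul.unlock; apply/clsP/asboolP; rewrite !clean_cat.
by apply: beq_cat; apply/asboolP/clsP; rewrite cls_repr.
Qed.

Lemma bmulV n (x : braid n) : bmul x (binv x) = cls n [::].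
Proof.
rewrite -{1}(cls_repr x) bmulE; apply/clsP/asboolP.
by rewrite clean_cat clean_winv; apply: beq_mulV; exact: valid_clean.
Qed.

Lemma bmulA n : associative (@bmul n).
Proof.
by move=> x y z; rewrite -(cls_repr x) -(cls_repr y) -(cls_repr z) !bmulE catA.
Qed.
Lemma bmul1 n : left_id (cls n [::]) (@bmul n).
Proof. by move=> x; rewrite -(cls_repr x) bmulE. Qed.
Lemma bmulr1 n : right_id (cls n [::]) (@bmul n).
Proof. by move=> x; rewrite -(cls_repr x) bmulE cats0. Qed.
Lemma bVmul n : left_inverse (cls n [::]) (@binv n) (@bmul n).
Proof.
move=> x; have h : bmul (binv x) (binv (binv x)) = cls n [::] := bmulV _.
rewrite -[LHS](bmulr1) -h bmulA -(bmulA (binv x)) bmulV.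
by rewrite bmulr1 h.
Qed.

HB.instance Definition _ n := isGroup.Build (braid n)
  (@bmulA n) (@bmul1 n) (@bmulr1 n) (@bVmul n) (@bmulV n).


Local Open Scope group_scope.

Lemma cls_cat n u v : cls n (u ++ v) = cls n u * cls n v.
Proof. by rewrite -bmulE. Qed.

Lemma cls_nil n : cls n [::] = 1.
Proof. by []. Qed.

Lemma cls_winv n w : cls n (winv w) = (cls n w)^-1.
Proof.
apply/esym/mulg1_eq; rewrite -cls_cat -cls_nil; apply/clsP/asboolP.
by rewrite clean_cat clean_winv; apply: beq_mulV; exact: valid_clean.
Qed.

Lemma cls_flatten n (ws : seq word) : cls n (flatten ws) = \prod_(w <- ws) cls n w.
Proof. by elim: ws => [|w ws IH] /=; rewrite ?big_nil ?big_cons ?cls_cat ?IH. Qed.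

Lemma cls_wpow_nat n w k : cls n (wpow w (Posz k)) = cls n w ^+ k.
Proof. by rewrite /= cls_flatten big_nseq -Monoid.iteropE. Qed.

Lemma cls_wpow_neg n w (k : nat) : cls n (wpow w (- (Posz k))%R) = cls n w ^- k.
Proof.
case: k => [|k]; first by rewrite cls_wpow_nat invg1.
rewrite -NegzE; have -> : wpow w (Negz k) = wpow (winv w) (Posz k.+1) by [].
by rewrite cls_wpow_nat cls_winv expVgn.
Qed.

(** * Band generators and the Birman-Ko-Lee relations *)

Definition sigma n i : braid n := cls n [:: (i, true)].
Definition bgen n i j : braid n := cls n (band i j).

Lemma cls_sgV n i : cls n [:: (i, false)] = (sigma n i)^-1.
Proof. by rewrite -cls_winv. Qed.

Lemma cls_cons n l w : cls n (l :: w) = cls n [:: l] * cls n w.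
Proof. by rewrite -cls_cat. Qed.

Lemma sigma_comm n i j : 0 < i < n -> 0 < j < n -> (i.+1 < j) || (j.+1 < i) ->
  commute (sigma n i) (sigma n j).
Proof.
by move=> *; rewrite /commute -!cls_cat; apply/beq_cls/elem_rel_beq; exact: er_comm.
Qed.

Lemma sigma_braid n i : 0 < i -> i.+1 < n ->
  sigma n i * sigma n i.+1 * sigma n i = sigma n i.+1 * sigma n i * sigma n i.+1.
Proof.
by move=> *; rewrite -!cls_cat /=; apply/beq_cls/elem_rel_beq/er_braid.
Qed.

Lemma commute_word n (x : braid n) w :
  (forall l : letter, l \in w -> commute x (sigma n l.1)) -> commute x (cls n w).
Proof.
elim: w => [|[i b] w IH] h; first by rewrite cls_nil; exact: commute1.
rewrite cls_cons; apply: commuteM; last by apply: IH => l lw; apply: h; rewrite inE lw orbT.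
have := h (i, b) (mem_head _ _).
by case: b {h} => // h; rewrite cls_sgV; exact: commuteV.
Qed.

Lemma mem_band i j (l : letter) : j < i -> l \in band i j -> j <= l.1 < i.
Proof.
move=> ji; rewrite /band ji /band_aux !mem_cat inE => /or3P[/mapP[k]|/eqP->|/mapP[k]].
- by rewrite mem_rev mem_iota => hk -> /=; lia.
- by rewrite /= ; lia.
- by rewrite mem_iota => hk -> /=; lia.
Qed.

Lemma valid_band n i j : 0 < j < i -> i <= n -> valid n (band i j).
Proof.
move=> /andP[j0 ji] hn; apply/allP => l /(mem_band ji) /= h.
by lia.
Qed.

Lemma bandSn j : band j.+1 j = [:: (j, true)].
Proof. by rewrite /band ltnSn /band_aux subnn. Qed.

Lemma bandS i j : j < i -> band i.+1 j = (i, true) :: band i j ++ [:: (i, false)].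
Proof.
move=> ji; rewrite /band ltnS (ltnW ji) ji /band_aux.
have -> : i.+1 - j.+1 = (i - j.+1) + 1 by lia.
rewrite iotaD /=; have -> : j.+1 + (i - j.+1) = i by lia.
by rewrite rev_cat map_cat /= map_cat /= -!catA.
Qed.

Section Bands.
Variable n : nat.
Local Notation sigma := (sigma n).
Local Notation bgen := (bgen n).

Lemma bdSn j : bgen j.+1 j = sigma j.
Proof. by rewrite /bgen bandSn. Qed.

Lemma bdS i j : j < i -> bgen i.+1 j = bgen i j ^ (sigma i)^-1.
Proof.
by move=> ji; rewrite /bgen bandS // cls_cons cls_cat cls_sgV /conjg invgK !mulgA.
Qed.

Lemma bgen_far i j k : 0 < j < i -> i <= n -> 0 < k < n -> (k.+1 < j) || (i < k) ->
  commute (sigma k) (bgen i j).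
Proof.
move=> ji hn kn far; apply: commute_word => l lb.
have := mem_band (proj2 (andP ji)) lb => ?.
by apply: sigma_comm; lia.
Qed.

Lemma commuteJ (x y z : braid n) : commute x y -> commute x z -> commute x (y ^ z).
Proof. by move=> xy xz; rewrite /conjg; do !apply: commuteM => //; exact: commuteV. Qed.

Lemma bgen_inner i j k : 0 < j < k -> k.+1 < i -> i <= n -> commute (sigma k) (bgen i j).
Proof.
move=> jk; elim: i => // i IH; rewrite ltnS leq_eqVlt => /orP[/eqP <-|ki] hn.
  (* Here [a_{k+2,j} = g X g^-1] with [g = sigma_{k+1} sigma_k]. The braid relation gives
     [sigma_k g = g sigma_{k+1}], and [sigma_{k+1}] commutes with [X]. *)
  rewrite bdS ?bdS; try lia.
  set X := bgen k j.
  have cX : commute (sigma k.+1) X by apply: bgen_far; lia.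
  rewrite /commute /conjg !invgK !mulgA.
  have br := sigma_braid (n := n) (i := k) ltac:(lia) ltac:(lia).
  rewrite br -(mulgA _ (sigma k.+1) X) cX !mulgA.
  rewrite -!mulgA; do 3!congr (_ * _).
  apply: (mulgI (sigma k)); apply: (mulgI (sigma k.+1)).
  by rewrite !mulgA -br !mulgK mulgV mul1g.
rewrite bdS; last lia.
apply: commuteJ; first by apply: IH; lia.
by apply: commuteV; apply: sigma_comm; lia.
Qed.

(** [bdS] peels off the upper index; peeling off the lower one allows induction on [i - j] with [i]
    fixed, as in [bgen_braid]. *)
Lemma bgen_low i j : 0 < j -> j.+1 < i -> i <= n -> bgen i j = bgen i j.+1 ^ sigma j.
Proof.
move=> j0; elim: i => // i IH; rewrite ltnS leq_eqVlt => /orP[/eqP <-|ji] hn.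
  rewrite bdS // !bdSn /conjg invgK.
  have br := sigma_braid (n := n) (i := j) ltac:(lia) ltac:(lia).
  apply: (mulgI (sigma j)); apply: (mulIg (sigma j.+1)).
  by rewrite !mulgA mulgV mul1g -br -!mulgA mulVg mulg1.
rewrite bdS ?IH ?bdS; try lia.
rewrite -!conjgM; congr (_ ^ _); apply: commuteV.
by apply: sigma_comm; lia.
Qed.

Lemma bgen_braid s r : 0 < r < s -> s < n ->
  sigma s * bgen s r * sigma s = bgen s r * sigma s * bgen s r.
Proof.
move=> rs sn; move: rs; have [m] := ubnP (s - r); elim: m r => // m IH r hm rs.
have [e|ne] := eqVneq s r.+1.
  by rewrite e bdSn; rewrite sigma_braid //; lia.
rewrite bgen_low; try lia.
have h : sigma s ^ sigma r = sigma s.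
  by apply/conjg_fixP/commgP/sigma_comm; lia.
by rewrite -{1 2 3}h -!conjMg IH //; lia.
Qed.

(** With [bgen_tri2] this is the triangular relation [a_{ts} a_{sr} = a_{tr} a_{ts} = a_{sr}
    a_{tr}]. Conjugation by [sigma t] moves only the index [t], which leaves the case [t = s+1]. *)
Lemma bgen_tri1 t s r : 0 < r < s -> s < t <= n ->
  bgen t s * bgen s r = bgen t r * bgen t s.
Proof.
move=> rs /andP[]; elim: t => // t IH; rewrite ltnS leq_eqVlt => /orP[/eqP <-|st] hn.
  by rewrite bdSn bdS ?/conjg ?invgK -?mulgA ?mulVg ?mulg1 //; lia.
have fx : bgen s r = bgen s r ^ (sigma t)^-1.
  by apply/esym/conjg_fixP/commgP/commute_sym; apply/commute_sym/commuteV/commute_sym/bgen_far; lia.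
by rewrite fx !bdS -?conjMg ?IH //; lia.
Qed.

Lemma bgen_tri2 t s r : 0 < r < s -> s < t <= n ->
  bgen t r * bgen t s = bgen s r * bgen t r.
Proof.
move=> rs /andP[]; elim: t => // t IH; rewrite ltnS leq_eqVlt => /orP[/eqP <-|st] hn.
  rewrite bdSn bdS; last lia.
  apply: (mulIg (sigma s)); rewrite /conjg invgK !mulgA !mulgVK.
  by rewrite bgen_braid //; lia.
have fx : bgen s r = bgen s r ^ (sigma t)^-1.
  by apply/esym/conjg_fixP/commgP/commute_sym; apply/commute_sym/commuteV/commute_sym/bgen_far; lia.
by rewrite fx !bdS -?conjMg ?IH //; lia.
Qed.

Lemma bgen_sep i j k l : 0 < j < i -> i < l < k -> k <= n -> commute (bgen i j) (bgen k l).
Proof.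
move=> ji lk kn; apply/commute_sym/commute_word => a /(mem_band (proj2 (andP ji))) ha.
by apply/commute_sym/bgen_far; lia.
Qed.

Lemma bgen_nest i j k l : 0 < j < l -> l < k < i -> i <= n -> commute (bgen i j) (bgen k l).
Proof.
move=> jl /andP[lk ki] kn; apply/commute_word => a /(mem_band lk) ha.
by apply/commute_sym/bgen_inner; lia.
Qed.

(** [sigma i] commutes with the letters of [delta] until it meets [sigma_{i+1} sigma_i], where the
    braid relation raises its index; the raised letter commutes with the rest. *)
Lemma sigma_delta_aux i m : 0 < i < m -> m < n ->
  sigma i * cls n (delta m.+1) = cls n (delta m.+1) * sigma i.+1.
Proof.
have deltaS k : cls n (delta k.+2) = sigma k.+1 * cls n (delta k.+1).
  have e : iota 1 k.+1 = iota 1 k ++ [:: k.+1] by have := iotaD 1 k 1; rewrite addn1 add1n.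
  by rewrite -cls_cat /delta [k.+2.-1]/= e rev_cat.
case/andP=> i0; elim: m => // m IH; rewrite ltnS leq_eqVlt => /orP[/eqP <-|im] hn.
  case: i i0 {IH} hn => // i _ hn; rewrite !deltaS !mulgA.
  rewrite sigma_braid // -!mulgA; do 2!congr (_ * _).
  apply: commute_word => l /mapP[k]; rewrite mem_rev mem_iota => hk -> /=.
  by apply: sigma_comm; lia.
rewrite deltaS mulgA (sigma_comm (j := m.+1)); try lia.
by rewrite -mulgA IH ?mulgA //; lia.
Qed.

Lemma sigma_delta i : 0 < i -> i.+1 < n -> sigma i * cls n (delta n) = cls n (delta n) * sigma i.+1.
Proof.
move=> i0 im; have := @sigma_delta_aux i n.-1.
have -> : n.-1.+1 = n by lia.
by apply; lia.
Qed.

End Bands.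

(** * The permutation of a braid *)

(* Point 0 of ['I_n.+1] is a dummy, fixed by every permutation considered, so
   that ordinals and the strands 1..n share their numbering. *)
Definition wperm n (w : word) : {perm 'I_n.+1} :=
  \prod_(l <- w | 0 < l.1 < n) tperm (inord l.1) (inord l.1.+1).

Lemma wperm_cat n u v : wperm n (u ++ v) = wperm n u * wperm n v.
Proof. exact: big_cat. Qed.

Lemma wperm_clean n w : wperm n (clean n w) = wperm n w.
Proof. by rewrite /wperm /clean big_filter_cond; apply: eq_bigl => l; rewrite andbb. Qed.

Lemma inord_eq n x y : x <= n -> y <= n -> (@inord n x == inord y) = (x == y).
Proof. by move=> *; rewrite -val_eqE /= !inordK. Qed.

Lemma wperm_beq n u v : beq n u v -> wperm n u = wperm n v.
Proof.
elim=> {u v} [u v l r|//|w1 w2 _ ->//|w1 w2 w3 _ -> _ ->//].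
move=> lr; rewrite !wperm_cat; congr (_ * (_ * _)).
case: lr => [i b hi|i j b c hi hj hij|i hi hin]; rewrite /wperm !big_cons big_nil /=.
- by rewrite hi mulg1 tperm2.
- rewrite hi hj !mulg1; rewrite conjgC; congr (_ * _).
  by rewrite tpermJ !tpermD // inord_eq; lia.
- have -> : 0 < i < n by lia.
  rewrite hin !mulg1.
  set x := inord i; set y := inord i.+1; set z := inord i.+2.
  have e1 : tperm x y * (tperm y z * tperm x y) = tperm y z ^ tperm x y.
    by rewrite /conjg tpermV.
  have e2 : tperm y z * (tperm x y * tperm y z) = tperm x y ^ tperm y z.
    by rewrite /conjg tpermV.
  rewrite e1 e2 !tpermJ !tpermL !tpermR; rewrite !tpermD // inord_eq; lia.
Qed.

Definition braid_perm n (x : braid n) := wperm n (generic_quotient.repr x).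

Lemma braid_perm_cls n w : braid_perm (cls n w) = wperm n w.
Proof.
have /clsP/asboolP/wperm_beq := cls_repr (cls n w).
by rewrite !wperm_clean.
Qed.

Lemma phiF n : {morph @braid_perm n : x y / (x * y^-1)%g}.
Proof.
move=> x y; rewrite -(cls_repr x) -(cls_repr y) -cls_winv -cls_cat !braid_perm_cls wperm_cat.
congr (_ * _); apply/esym/mulg1_eq; rewrite -wperm_cat -!braid_perm_cls cls_cat cls_winv mulgV.
by rewrite -cls_nil braid_perm_cls /wperm big_nil.
Qed.

HB.instance Definition _ n := isGroupMorphism.Build (braid n) {perm 'I_n.+1} (@braid_perm n) (@phiF n).

Lemma phiM n : {morph @braid_perm n : x y / x * y}. Proof. exact: gmulfM. Qed.
Lemma phi1 n : @braid_perm n 1 = 1. Proof. exact: gmulf1. Qed.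
Lemma phiX n k : {morph @braid_perm n : x / x ^+ k}. Proof. exact: gmulfXn. Qed.
Lemma phiV n : {morph @braid_perm n : x / x^-1}. Proof. exact: gmulfV. Qed.
Lemma phiJ n : {morph @braid_perm n : x y / x ^ y}. Proof. exact: gmulfJ. Qed.

Definition transp n (p : nat * nat) : {perm 'I_n.+1} := tperm (inord p.1) (inord p.2).

Lemma braid_perm_bgen n i j : 0 < j < i -> i <= n -> braid_perm (bgen n i j) = transp n (i, j).
Proof.
case/andP=> j0; elim: i => // i IH; rewrite ltnS leq_eqVlt => /orP[/eqP <-|ji] hn.
  rewrite bdSn braid_perm_cls /wperm big_cons big_nil /= j0 hn mulg1.
  by rewrite /transp tpermC.
rewrite bdS // phiJ phiV IH; try lia.
rewrite braid_perm_cls /wperm big_cons big_nil /= hn mulg1 (leq_trans _ ji) //=.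
rewrite tpermV /transp tpermJ /= tpermL tpermD // inord_eq; lia.
Qed.

(** * Band words, their permutations and cycle counts *)

(** A band word is kept as a list of index pairs, as in [pos]: its length, its permutation and its
    braid are then three readings of one list. *)
Definition bwf n (s : seq (nat * nat)) :=
  all (fun p => (1 <= p.2)%N && (p.2 < p.1)%N && (p.1 <= n)%N) s.
Definition bword (s : seq (nat * nat)) : word := flatten [seq band p.1 p.2 | p <- s].
Definition bprod n s : braid n := \prod_(p <- s) bgen n p.1 p.2.
Definition bperm n (s : seq (nat * nat)) : {perm 'I_n.+1} := \prod_(p <- s) transp n p.

Lemma bwf_cat n s t : bwf n (s ++ t) = bwf n s && bwf n t.
Proof. exact: all_cat. Qed.

Lemma bprod_cat n s t : bprod n (s ++ t) = bprod n s * bprod n t.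
Proof. exact: big_cat. Qed.

Lemma bprod_cons n p s : bprod n (p :: s) = bgen n p.1 p.2 * bprod n s.
Proof. exact: big_cons. Qed.

Lemma bperm_cat n s t : bperm n (s ++ t) = bperm n s * bperm n t.
Proof. exact: big_cat. Qed.

Lemma bperm_cons n p s : bperm n (p :: s) = transp n p * bperm n s.
Proof. exact: big_cons. Qed.

Lemma cls_bword n s : cls n (bword s) = bprod n s.
Proof. by rewrite /bword cls_flatten big_map. Qed.

Lemma valid_bword n s : bwf n s -> valid n (bword s).
Proof.
move=> /allP h; rewrite valid_flatten all_map; apply/allP => p /h /= hp.
by apply: valid_band; lia.
Qed.

Lemma braid_perm_bprod n s : bwf n s -> braid_perm (bprod n s) = bperm n s.
Proof.
elim: s => [|[i j] s IH] /=; first by rewrite /bprod /bperm !big_nil phi1.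
by move=> /andP[hp /IH hs]; rewrite bprod_cons phiM hs bperm_cons braid_perm_bgen //=; lia.
Qed.

Lemma bperm_inv n s (A : pred nat) (z : 'I_n.+1) : bwf n s ->
  (forall p : nat * nat, p \in s -> A p.1 = A p.2) -> A (bperm n s z) = A z.
Proof.
elim: s z => [|[i j] s IH] z /=; first by rewrite /bperm big_nil perm1.
move=> /andP[hp hs] h; rewrite bperm_cons permM IH //; last first.
  by move=> p ps; apply: h; rewrite inE ps orbT.
have := h (i, j) (mem_head _ _); rewrite /transp /= => e.
by case: tpermP => [->|->|//]; rewrite !inordK //=; lia.
Qed.

Lemma bperm_fix n s z : bwf n s -> z <= n ->
  (forall p : nat * nat, p \in s -> (p.1 != z) && (p.2 != z)) -> bperm n s (inord z) = inord z.
Proof.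
move=> hs hz h; apply/val_inj/eqP => /=; rewrite inordK //.
have -> : (bperm n s (inord z) == z :> nat) = pred1 z (@inord n z : nat).
  by apply: (bperm_inv (A := pred1 z)) => // p /h /andP[/= /negbTE -> /negbTE ->].
by rewrite /= inordK.
Qed.

Lemma porbits1 (T : finType) : #|porbits (1 : {perm T})| = #|T|.
Proof.
rewrite card_imset // => x y /eqP; rewrite eq_porbit_mem => /porbitP[i].
by rewrite expg1n perm1.
Qed.

(** Fixed points count as cycles, the dummy point 0 among them, so the identity has [n+1]. *)
Definition norb n (q : {perm 'I_n.+1}) : nat := #|porbits q|.

Lemma norb_transp n i j (q : {perm 'I_n.+1}) : 0 < j < i -> i <= n ->
  norb (transp n (i, j) * q) = if inord i \in porbit q (inord j) then (norb q).+1 else (norb q).-1.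
Proof.
move=> ji hn; have := porbits_mul_tperm q (inord i) (inord j).
rewrite inord_eq; try lia.
have -> : (i != j) = true by lia.
rewrite /norb /transp /=; set a := #|_|; set b := #|_|.
by case: (_ \in _); rewrite /= ?double0; lia.
Qed.

(** A transposition lowers the number of cycles by at most one. *)
Lemma norb_bperm n s : bwf n s -> n < norb (bperm n s) + size s.
Proof.
elim: s => [|[i j] s IH] /=.
  by rewrite /bperm /norb big_nil porbits1 card_ord addn0.
move=> /andP[hp /IH hs]; rewrite bperm_cons norb_transp; try lia.
by case: ifP; lia.
Qed.

(** * Noncrossing partitions as band words *)

Definition chain (T : seq nat) : seq (nat * nat) := [seq (p.2, p.1) | p <- rev (zip T (behead T))].
Definition chains (P : seq (seq nat)) : seq (nat * nat) := flatten [seq chain T | T <- P].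

Lemma bword_chain T : bword (chain T) = subsimple T.
Proof. by rewrite /bword /chain /subsimple -map_comp. Qed.

Lemma bword_cat s t : bword (s ++ t) = bword s ++ bword t.
Proof. by rewrite /bword map_cat flatten_cat. Qed.

Lemma bword_chains P : bword (chains P) = flatten [seq subsimple T | T <- P].
Proof. by elim: P => //= T P IH; rewrite bword_cat bword_chain IH. Qed.

Lemma chain_cons x y T : chain (x :: y :: T) = chain (y :: T) ++ [:: (y, x)].
Proof. by rewrite /chain /= rev_cons -cats1 map_cat. Qed.

Lemma chain_cat T1 x T2 : chain (T1 ++ x :: T2) = chain (x :: T2) ++ chain (rcons T1 x).
Proof.
elim: T1 => [|y T1 IH]; first by rewrite cats0.
case: T1 IH => [_|z T1 IH]; first by rewrite chain_cons.
have -> : [:: y, z & T1] ++ x :: T2 = y :: z :: (T1 ++ x :: T2) by [].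
by rewrite chain_cons -cat_cons IH /= chain_cons catA.
Qed.

Lemma size_chain T : size (chain T) = (size T).-1.
Proof. by rewrite /chain size_map size_rev size_zip size_behead; lia. Qed.

Lemma mem_chain T (p : nat * nat) : sorted ltn T -> p \in chain T -> [/\ p.1 \in T, p.2 \in T & p.2 < p.1].
Proof.
elim: T => [|x [|y T] IH] //; rewrite chain_cons => /andP[xy sT].
rewrite mem_cat inE => /orP[/(IH sT) [h1 h2 ->]|/eqP -> /=].
  by rewrite !(in_cons x) h1 h2 !orbT.
by rewrite !inE !eqxx !orbT.
Qed.

Definition blockok n (T : seq nat) := sorted ltn T && all (fun x => 0 < x <= n) T.
(** Singletons are allowed among the blocks, because splitting a block produces them; their chains
    are empty. *)
Definition noncrossing n (P : seq (seq nat)) := all (blockok n) P && pairwise noncrossing_disjoint P.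

Lemma ndP T U : reflect
  ((forall x, x \in T -> x \notin U) /\
   forall a b c e, a \in T -> c \in T -> b \in U -> e \in U ->
     (~ (a < b < c /\ c < e)) /\ ~ (b < a < e /\ e < c))
  (noncrossing_disjoint T U).
Proof.
rewrite /noncrossing_disjoint -andbA.
apply: (iffP and3P) => [[/hasPn h1 /allP h2 /allP h3]|[h1 h2]].
  split=> [x /h1 //|a b c e aT cT bU eU].
  split=> h.
    have /allP/(_ _ cT)/allP/(_ _ bU)/allP/(_ _ eU) := h2 _ aT; lia.
  have /allP/(_ _ eU)/allP/(_ _ aT)/allP/(_ _ cT) := h3 _ bU; lia.
split.
- by apply/hasPn => x /h1.
- apply/allP => a aT; apply/allP => c cT; apply/allP => b bU; apply/allP => e eU.
  by have [] := h2 a b c e aT cT bU eU; lia.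
- apply/allP => b bU; apply/allP => e eU; apply/allP => a aT; apply/allP => c cT.
  by have [] := h2 a b c e aT cT bU eU; lia.
Qed.

Lemma nd_sym : symmetric noncrossing_disjoint.
Proof.
move=> T U; apply/idP/idP => /ndP[h1 h2]; apply/ndP; split=> [x xT|a b c e *].
- by apply/negP => /h1; rewrite xT.
- by have [] := h2 b a e c; rewrite ?inE //; split=> ?; lia.
- by apply/negP => /h1; rewrite xT.
- by have [] := h2 b a e c; rewrite ?inE //; split=> ?; lia.
Qed.

Lemma nd_sub T T' U : {subset T' <= T} -> noncrossing_disjoint T U -> noncrossing_disjoint T' U.
Proof.
move=> sT /ndP[h1 h2]; apply/ndP; split=> [x /sT|a b c e /sT ? /sT]; first exact: h1.
exact: h2.
Qed.

Lemma blockok_chain n T : blockok n T -> bwf n (chain T).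
Proof.
case/andP=> sT /allP aT; apply/allP => p /(mem_chain sT) [/aT /= h1 /aT /= h2 h3] /=; lia.
Qed.

Lemma bwf_chains n P : all (blockok n) P -> bwf n (chains P).
Proof. by elim: P => //= T P IH /andP[/blockok_chain hT /IH hP]; rewrite bwf_cat hT. Qed.

Lemma commute_bprod n (x : braid n) s :
  (forall p : nat * nat, p \in s -> commute x (bgen n p.1 p.2)) -> commute x (bprod n s).
Proof.
elim: s => [|p s IH] h; first by rewrite /bprod big_nil; exact: commute1.
rewrite bprod_cons; apply: commuteM; first by apply: h; rewrite mem_head.
by apply: IH => q qs; apply: h; rewrite inE qs orbT.
Qed.

Lemma commute_bprod2 n s t :
  (forall p q : nat * nat, p \in s -> q \in t -> commute (bgen n p.1 p.2) (bgen n q.1 q.2)) ->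
  commute (bprod n s) (bprod n t).
Proof.
move=> h; apply: commute_bprod => q qt; apply/commute_sym/commute_bprod => p ps.
exact/commute_sym/h.
Qed.

(** Two disjoint chords that do not cross are either separated or nested. *)
Lemma bgen_noncrossing n i j k l : 0 < j < i -> i <= n -> 0 < l < k -> k <= n ->
  i != k -> i != l -> j != k -> j != l -> ~ (j < l < i /\ i < k) -> ~ (l < j < k /\ k < i) ->
  commute (bgen n i j) (bgen n k l).
Proof.
move=> ji hi lk hk d1 d2 d3 d4 c1 c2.
have [|] := ltnP i l; first by move=> il; apply: bgen_sep; lia.
have [|] := ltnP k j; first by move=> kj *; apply/commute_sym/bgen_sep; lia.
have [|] := ltnP j l; first by move=> *; apply: bgen_nest; lia.
by move=> *; apply/commute_sym/bgen_nest; lia.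
Qed.

Lemma chain_comm n T U : blockok n T -> blockok n U -> noncrossing_disjoint T U ->
  commute (bprod n (chain T)) (bprod n (chain U)).
Proof.
move=> /andP[sT /allP aT] /andP[sU /allP aU] /ndP[h1 h2].
apply: commute_bprod2 => p q /(mem_chain sT) [p1 p2 bperm] /(mem_chain sU) [q1 q2 qq].
have /= ? := aT _ p1; have /= ? := aT _ p2; have /= ? := aU _ q1; have /= ? := aU _ q2.
have [? ?] := h2 _ _ _ _ p2 p1 q2 q1.
have [/negP d1 /negP d2] := (h1 _ p1, h1 _ p2).
by apply: bgen_noncrossing; try lia; apply/eqP => e; [apply: d1|apply: d1|apply: d2|apply: d2];
  rewrite e.
Qed.

Lemma chains_cat P Q : chains (P ++ Q) = chains P ++ chains Q.
Proof. by rewrite /chains map_cat flatten_cat. Qed.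

Lemma chains_cons T P : chains (T :: P) = chain T ++ chains P.
Proof. by []. Qed.

Lemma mem_chains P (p : nat * nat) : p \in chains P -> exists2 T, T \in P & p \in chain T.
Proof. by move=> /flattenP[_ /mapP[T TP ->] pT]; exists T. Qed.

Lemma chains_comm n T P : blockok n T -> all (blockok n) P -> all (noncrossing_disjoint T) P ->
  commute (bprod n (chain T)) (bprod n (chains P)).
Proof.
move=> bT; elim: P => [|U P IH] /=; first by rewrite /bprod big_nil => *; exact: commute1.
move=> /andP[bU bP] /andP[nU nP]; rewrite chains_cons bprod_cat.
by apply: commuteM; [exact: chain_comm | exact: IH].
Qed.

Lemma noncrossing_front n P1 T P2 : noncrossing n (P1 ++ T :: P2) ->
  noncrossing n (T :: P1 ++ P2) /\ bprod n (chains (P1 ++ T :: P2)) = bprod n (chains (T :: P1 ++ P2)).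
Proof.
rewrite /noncrossing !all_cat /= !pairwise_cat /=.
move=> /andP[/and3P[b1 bT b2] /and3P[r12 w1 /andP[w2 w3]]].
move: r12; rewrite allrel_consr => /andP[r1T r12].
have nT1 : all (noncrossing_disjoint T) P1.
  by apply: sub_all r1T => U; rewrite nd_sym.
split; first by rewrite /= !all_cat ?pairwise_cat bT b1 b2 nT1 w1 w2 w3 r12.
rewrite chains_cons !chains_cat chains_cons !bprod_cat !mulgA; congr (_ * _).
exact/esym/chains_comm.
Qed.

(** * Pulling a band generator out of a block *)

Section Split.
Variable n : nat.

Lemma sorted_ltn_cat T x U : sorted ltn (T ++ x :: U) =
  [&& sorted ltn (rcons T x) & path ltn x U].
Proof.
case: T => [|y T] //=.
by rewrite -cat_rcons cat_path last_rcons.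
Qed.

Lemma path_ltn x T : path ltn x T -> forall y : nat, y \in T -> x < y.
Proof. by move=> /(order_path_min ltn_trans)/allP. Qed.

Lemma path_rcons_le j T i : path ltn j (rcons T i) -> forall y : nat, y \in rcons T i -> y <= i.
Proof.
elim: T j => [|k T IH] j /= /andP[jk pk] y; first by rewrite inE => /eqP ->.
rewrite inE => /orP[/eqP ->|]; last exact: IH pk y.
by apply/ltnW/(path_ltn pk); rewrite mem_rcons mem_head.
Qed.

(** Each triangular relation lengthens the chord at [j] by one step, until it reaches the top of the
    block. *)
Lemma hook_low j T i : path ltn j (rcons T i) -> 0 < j -> i <= n ->
  bprod n (chain (j :: rcons T i)) = bgen n i j * bprod n (chain (rcons T i)).
Proof.
elim: T j => [|k T IH] j.
  by move=> *; rewrite /chain /bprod /= !big_cons !big_nil.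
rewrite /= => /andP[jk pk] j0 hi.
have kT := path_ltn pk.
have ki : k < i by apply: kT; rewrite mem_rcons mem_head.
rewrite chain_cons bprod_cat IH //; last lia.
rewrite {2}/bprod big_cons big_nil mulg1 /=.
rewrite -mulgA; have -> : bprod n (chain (rcons T i)) * bgen n k j = bgen n k j * bprod n (chain (rcons T i)).
  apply/commute_sym/commute_bprod => p /(mem_chain (path_sorted pk)) [p1 p2 h3].
  have h1 := kT _ p1; have h2 := kT _ p2; have h4 := path_rcons_le pk p1.
  by apply: bgen_sep; lia.
by rewrite !mulgA bgen_tri1; try lia.
Qed.

(** Moving [a_{ij}] to the left replaces the endpoint [i] by [j]: both triangular relations act on
    the lowest chord [a_{ki}], and the remaining chords lie above [i] and commute with [a_{ij}]. *)
Lemma hook_high j i T : path ltn i T -> 0 < j < i -> all (fun x => x <= n) T ->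
  bprod n (chain (i :: T)) * bgen n i j = bgen n i j * bprod n (chain (j :: T)).
Proof.
case: T => [|k T]; first by move=> *; rewrite /chain /bprod /= !big_nil mul1g mulg1.
move=> pi ji /allP hn; have iT := path_ltn pi; have := pi; rewrite /= => /andP[ik pk].
have kT := path_ltn pk.
have hk : k <= n by apply: hn; rewrite mem_head.
rewrite !chain_cons !bprod_cat [bprod n [:: (k, i)]]big_seq1 [bprod n [:: (k, j)]]big_seq1 /=.
rewrite -mulgA bgen_tri1; try lia.
rewrite bgen_tri2; try lia.
rewrite !mulgA; congr (_ * _).
apply/commute_sym/commute_bprod => p /(mem_chain (T := k :: T) pk) [p1 p2 h3].
have h1 := iT _ p1; have h2 := iT _ p2; have h4 := hn _ p1.
by apply: bgen_sep => /=; lia.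
Qed.

(** Multiplying a cycle by a transposition of two of its points cuts it in two; this is the lift of
    that fact to braids. The two pieces are the points in [(j, i]] and all the others. *)
Lemma split_block T1 j T2 i T3 : let T := T1 ++ j :: T2 ++ i :: T3 in
  blockok n T ->
  [/\ blockok n (rcons T2 i), blockok n (T1 ++ j :: T3),
     noncrossing_disjoint (rcons T2 i) (T1 ++ j :: T3)
   & bprod n (chain T) = bgen n i j * bprod n (chain (rcons T2 i)) * bprod n (chain (T1 ++ j :: T3))].
Proof.
move=> T /andP[]; rewrite {1}/T sorted_ltn_cat => /andP[s1 sj] aT.
move: (sj); rewrite -cat_rcons cat_path last_rcons => /andP[p2 p3].
have aT' := allP aT.
have mT (x : nat) : x \in T = [|| x \in T1, x == j, x \in T2, x == i | x \in T3].
  by rewrite /T mem_cat inE mem_cat inE.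
have ji : j < i by apply: (path_ltn p2); rewrite mem_rcons mem_head.
have lt1 (x : nat) : x \in T1 -> x < j.
  move: s1; rewrite -cats1 => s1 xT1.
  have := s1; rewrite (sorted_pairwise ltn_trans) pairwise_cat allrel_consr.
  by case/and3P=> /andP[/allP/(_ _ xT1)].
have gt3 (x : nat) : x \in T3 -> i < x by apply: path_ltn.
have sjT3 : path ltn j T3.
  case: (T3) p3 => //= k T4 /andP[h ->]; rewrite andbT; exact: ltn_trans h.
have bA : blockok n (rcons T2 i).
  rewrite /blockok (path_sorted p2) /=; apply/allP => x; rewrite mem_rcons inE => h.
  by apply: aT'; rewrite mT; case/orP: h => ->; rewrite ?orbT.
have bB : blockok n (T1 ++ j :: T3).
  rewrite /blockok sorted_ltn_cat s1 sjT3 /=; apply/allP => x; rewrite mem_cat inE => h.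
  by apply: aT'; rewrite mT; case/or3P: h => ->; rewrite ?orbT.
have nAB : noncrossing_disjoint (rcons T2 i) (T1 ++ j :: T3).
  have hA (x : nat) : x \in rcons T2 i -> j < x <= i.
    by move=> h; rewrite (path_ltn p2) // (path_rcons_le p2).
  have hB (x : nat) : x \in T1 ++ j :: T3 -> x <= j \/ i < x.
    by rewrite mem_cat inE => /or3P[/lt1|/eqP|/gt3]; lia.
  apply/ndP; split=> [x /hA h|a b c e /hA h1 /hA h2 /hB h3 /hB h4]; last lia.
  by apply/negP => /hB; lia.
split=> //.
have j0 : 0 < j by have /= := aT' j; rewrite mT eqxx orbT => /(_ isT); lia.
have hi : i <= n by have /= := aT' i; rewrite mT eqxx !orbT => /(_ isT); lia.
(* The chain is cut at [i] and at [j]. [a_{ij}] is formed from the middle part by [hook_low] and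
   carried left by [hook_high]; then the chains of [j :: T3] and [rcons T2 i] change places. *)
rewrite /T (chain_cat T1) bprod_cat (chain_cat (j :: T2)) bprod_cat /= hook_low // !mulgA.
rewrite hook_high //; try lia.
  rewrite (chain_cat T1) bprod_cat !mulgA; congr (_ * _); rewrite -!mulgA; congr (_ * _).
  apply/commute_sym/chain_comm => //.
    have := bB; rewrite /blockok /= all_cat /= => /andP[_ /and3P[_ -> ->]].
    by rewrite sjT3.
  rewrite nd_sym; apply: nd_sub (_ : noncrossing_disjoint (T1 ++ j :: T3) _) => [x|].
    by rewrite mem_cat => ->; rewrite orbT.
  by rewrite nd_sym.
by apply/allP => x x3; have /= := aT' x; rewrite mT x3 !orbT => /(_ isT); lia.
Qed.

End Split.

(** * Cycles of noncrossing products *)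

Lemma porbit_fix (T : finType) (q : {perm T}) x y : q y = y -> x \in porbit q y -> x = y.
Proof. by move=> qy /porbitP[k ->]; rewrite permX_fix. Qed.

Lemma porbit_inv (T : finType) (q : {perm T}) (A : T -> bool) x y :
  (forall z, A (q z) = A z) -> x \in porbit q y -> A x = A y.
Proof.
move=> h /porbitP[k ->]; elim: k => [|k IH]; first by rewrite expg0 perm1.
by rewrite expgSr permM h.
Qed.

Lemma norb_gt0 n (q : {perm 'I_n.+1}) : 0 < norb q.
Proof. by apply/card_gt0P; exists (porbit q ord0); apply: imset_f. Qed.

(** The points of [T] are added in increasing order. The new point [z] is fixed by the word so far,
    so the new letter merges two distinct cycles. *)
Lemma norb_chain n T s : blockok n T -> bwf n s ->
  (forall p : nat * nat, p \in s -> (p.1 \notin T) && (p.2 \notin T)) ->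
  norb (bperm n (chain T ++ s)) + size (chain T) <= norb (bperm n s).
Proof.
elim/last_ind: T => [|T z IH]; first by rewrite /= addn0.
case/lastP: T IH => [|T y] IH; first by rewrite /= addn0.
move=> bT ws h.
have e : rcons (rcons T y) z = T ++ [:: y; z] by rewrite -!cats1 -catA.
have bT' : blockok n (rcons T y).
  move: bT; rewrite /blockok [rcons _ z]e sorted_ltn_cat all_cat all_rcons /=.
  by move=> /andP[/andP[-> _] /andP[-> /andP[-> _]]].
have ty : path ltn y [:: z].
  by move: bT; rewrite /blockok [rcons _ z]e sorted_ltn_cat => /andP[/andP[]].
have {}IH : norb (bperm n (chain (rcons T y) ++ s)) + size (chain (rcons T y)) <= norb (bperm n s).
  apply: IH => // p /h; rewrite !(mem_rcons _ z) !inE !negb_or.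
  by move=> /andP[/andP[_ ->] /andP[_ ->]].
have hz : (0 < z <= n) && (0 < y <= n).
  move: bT => /andP[_ /allP a]; apply/andP; split; apply: a.
    by rewrite mem_rcons mem_head.
  by rewrite mem_rcons inE mem_rcons mem_head orbT.
have le : forall x : nat, x \in rcons T y -> x < z.
  have sT : sorted ltn (rcons (rcons T y) z) by case/andP: bT.
  move: sT; rewrite (sorted_pairwise ltn_trans) -[rcons _ z]cats1 pairwise_cat allrel_consr.
  by move=> /andP[/andP[/allP hh _] _] x /hh.
have fx : bperm n (chain (rcons T y) ++ s) (inord z) = inord z.
  apply: bperm_fix; [by rewrite bwf_cat ws blockok_chain | lia |] => p.
  rewrite mem_cat => /orP[/(mem_chain (proj1 (andP bT'))) [/le h1 /le h2 _]|/h].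
    by rewrite !neq_ltn h1 h2.
  by rewrite !mem_rcons !inE !negb_or => /andP[/andP[-> _] /andP[-> _]].
have yz : y < z by apply: le; rewrite mem_rcons mem_head.
rewrite {1 2}e chain_cat [chain [:: y; z]]/= cat1s cat_cons bperm_cons norb_transp /=; try lia.
case: ifP => /= h'; last by move: IH (norb_gt0 (bperm n (chain (rcons T y) ++ s))); lia.
move: h'; rewrite porbit_sym => /(porbit_fix fx) /eqP; rewrite inord_eq; lia.
Qed.

Lemma noncrossing_disj n P T U : noncrossing n P -> T \in P -> U \in P -> T = U \/ noncrossing_disjoint T U.
Proof.
move=> nc /splitPr TP; case: P / TP nc => P1 P2 /noncrossing_front[/andP[_ /= /andP[/allP h _]] _].
by rewrite mem_cat inE orbCA -mem_cat => /orP[/eqP|/h]; [left|right].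
Qed.

Lemma norb_chains n P : noncrossing n P -> norb (bperm n (chains P)) + size (chains P) <= n.+1.
Proof.
elim: P => [|T P IH]; first by rewrite /bperm /chains /norb big_nil porbits1 card_ord addn0.
move=> /andP[/= /andP[bT bP] /andP[/allP ndT nP]].
have wP := bwf_chains bP.
have /(_ bT wP) := @norb_chain n T (chains P).
rewrite chains_cons size_cat; have h : noncrossing n P by apply/andP.
suff d : forall p : nat * nat, p \in chains P -> (p.1 \notin T) && (p.2 \notin T).
  by move=> /(_ d); have := IH h; lia.
move=> p /mem_chains[U UP]; have bU := allP bP _ UP.
move=> /(mem_chain (proj1 (andP bU)))[p1 p2 _].
have /ndP[d _] := ndT _ UP.
by apply/andP; split; apply/negP => /d; rewrite ?p1 ?p2.
Qed.

(** Membership in a block is invariant under the permutation, and a point outside all blocks is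
    fixed. *)
Lemma same_block n P i j : noncrossing n P -> 0 < j < i -> i <= n ->
  inord i \in porbit (bperm n (chains P)) (inord j) -> exists2 T, T \in P & (i \in T) && (j \in T).
Proof.
move=> nc ji hi hor; have wP := bwf_chains (proj1 (andP nc)).
have inb (p : nat * nat) U : U \in P -> p \in chain U -> (p.1 \in U) && (p.2 \in U).
  move=> UP pU; have /andP[sU _] := allP (proj1 (andP nc)) _ UP.
  by have [-> ->] := mem_chain sU pU.
case: (boolP (has (fun T : seq nat => j \in T) P)) => [/hasP[T TP jT]|/hasPn no].
  exists T => //; rewrite jT andbT.
  have inv (z : 'I_n.+1) : ((bperm n (chains P) z : nat) \in T) = ((z : nat) \in T).
    apply: (bperm_inv (A := fun x => x \in T)) => // p /mem_chains[U UP] pU.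
    have /andP[p1 p2] := inb _ _ UP pU.
    have [->|/ndP[d _]] := noncrossing_disj nc TP UP; first by rewrite p1 p2.
    have n1 : p.1 \notin T by apply/negP => /d; rewrite p1.
    have n2 : p.2 \notin T by apply/negP => /d; rewrite p2.
    by rewrite (negbTE n1) (negbTE n2).
  have := porbit_inv (A := fun z : 'I_n.+1 => (z : nat) \in T) inv hor.
  by rewrite !inordK ?jT //; lia.
have fx : bperm n (chains P) (inord j) = inord j.
  apply: bperm_fix => //; first lia.
  move=> p /mem_chains[U UP] pU; have /andP[p1 p2] := inb _ _ UP pU.
  by apply/andP; split; apply: contraNneq (no _ UP) => <-.
move: hor => /(porbit_fix fx) /eqP; rewrite inord_eq; lia.
Qed.

(** * Minimal words are determined by their permutations *)

(** Keeps track of supports while blocks are split; in the end it places the blocks of [b] inside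
    the blocks [{kd+2, ..., kd+d+1}]. *)
Definition refine (P' P : seq (seq nat)) :=
  forall T', T' \in P' -> exists2 T : seq nat, T \in P & {subset T' <= T}.

Lemma refine_trans P Q R : refine P Q -> refine Q R -> refine P R.
Proof.
move=> h1 h2 T /h1[U /h2[V VR sV] sU]; exists V => // x /sU; exact: sV.
Qed.

Lemma sorted_split (T : seq nat) i j : sorted ltn T -> i \in T -> j \in T -> j < i ->
  exists T1 T2 T3, T = T1 ++ j :: T2 ++ i :: T3.
Proof.
move=> sT iT jT ji; case/splitPr: jT sT iT => T1 U; rewrite mem_cat inE => sT.
have hU : i \in U -> exists T1' T2 T3, T1 ++ j :: U = T1' ++ j :: T2 ++ i :: T3.
  by case/splitPr=> T2 T3; exists T1, T2, T3.
case/or3P=> [iT1|/eqP e|/hU //]; last lia.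
move: sT; rewrite (sorted_pairwise ltn_trans) pairwise_cat allrel_consr.
by case/and3P=> /andP[/allP/(_ _ iT1)]; lia.
Qed.

Lemma step n P i j : noncrossing n P -> 0 < j < i -> i <= n ->
  inord i \in porbit (bperm n (chains P)) (inord j) ->
  exists P', [/\ noncrossing n P', bprod n (chains P) = bgen n i j * bprod n (chains P'),
     size (chains P) = (size (chains P')).+1 & refine P' P].
Proof.
move=> nc ji hi /(same_block nc ji hi)[T TP /andP[iT jT]].
have /andP[sT _] := allP (proj1 (andP nc)) _ TP.
have [T1 [T2 [T3 e]]] := sorted_split sT iT jT (proj2 (andP ji)).
case/splitPr: TP nc => P1 P2 nc.
have [/andP[/= /andP[bT bP] /andP[/allP nT nP]] eP] := noncrossing_front nc.
have [bA bB nAB eT] := split_block (T1 := T1) (T2 := T2) (T3 := T3) (j := j) (i := i) (eq_ind T (blockok n) bT _ e).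
set A := rcons T2 i in bA nAB eT; set B := T1 ++ j :: T3 in bB nAB eT.
have sA : {subset A <= T}.
  by move=> x; rewrite e !(mem_cat, inE, mem_rcons) => /orP[] ->; rewrite ?orbT.
have sB : {subset B <= T}.
  by move=> x; rewrite e !(mem_cat, inE, mem_rcons) => /or3P[] ->; rewrite ?orbT.
exists (A :: B :: P1 ++ P2); split.
- rewrite /noncrossing [all _ _]/= bA bB bP [pairwise _ _]/= nAB nP !andbT /=.
  by apply/andP; split; apply/allP => U /nT; [apply: nd_sub sA | apply: nd_sub sB].
- by rewrite eP e !chains_cons !bprod_cat eT !mulgA.
- rewrite !chains_cons !chains_cat !chains_cons !size_cat !size_chain e /A /B.
  by rewrite !size_cat /= !size_cat size_rcons /=; lia.
- move=> U; rewrite !inE => /or3P[/eqP ->|/eqP ->|].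
  + by exists T; rewrite // mem_cat mem_head orbT.
  + by exists T; rewrite // mem_cat mem_head orbT.
  + by rewrite mem_cat => UP; exists U => //; rewrite mem_cat inE orbCA UP orbT.
Qed.

Lemma peel0 n P s t : noncrossing n P -> bwf n (s ++ t) -> bperm n (s ++ t) = bperm n (chains P) ->
  size (s ++ t) = size (chains P) ->
  exists P', [/\ noncrossing n P', bprod n (chains P) = bprod n s * bprod n (chains P'),
     bperm n t = bperm n (chains P'), size t = size (chains P') & refine P' P].
Proof.
elim: s P => [|[i j] s IH] P nc.
  move=> _ /= e1 e2; exists P; split => //; first by rewrite /bprod big_nil mul1g.
  by move=> T TP; exists T.
rewrite cat_cons => /= /andP[hp w] e es.
have pn := norb_chains nc; have wn := norb_bperm w.
(* Removing the first letter leaves a word shorter by one, which has more cycles by [norb_bperm]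
   than [norb_chains] allows for [P]. So the letter cuts a cycle, and its two points lie in that
   cycle. *)
have hor : inord i \in porbit (bperm n (chains P)) (inord j).
  have := norb_transp (bperm n (chains P)) (i := i) (j := j) ltac:(lia) ltac:(lia).
  rewrite -e bperm_cons mulgA {1}/transp tperm2 mul1g -bperm_cons e.
  by case: ifP => // _; move: es => /=; lia.
have [P1 [nc1 e1 s1 r1]] := step nc (i := i) (j := j) ltac:(lia) ltac:(lia) hor.
have wP1 := bwf_chains (proj1 (andP nc1)).
have [||P' [nc' e' p' s' r']] := IH P1 nc1 w.
- apply: (mulgI (transp n (i, j))); rewrite -bperm_cons e -!braid_perm_bprod ?e1 ?phiM ?braid_perm_bgen //; try lia.
  exact: bwf_chains (proj1 (andP nc)).
- lia.
exists P'; split => //; first by rewrite e1 e' mulgA bprod_cons.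
exact: refine_trans r' r1.
Qed.

Lemma peel n P s t : noncrossing n P -> bwf n (s ++ t) -> bperm n (s ++ t) = bperm n (chains P) ->
  size (s ++ t) = size (chains P) ->
  exists P', [/\ noncrossing n P', bprod n (chains P) = bprod n s * bprod n t,
     bprod n t = bprod n (chains P'), size t = size (chains P') & refine P' P].
Proof.
move=> nc w e es; have [P' [nc' -> p' s' r']] := peel0 nc w e es.
suff h : bprod n t = bprod n (chains P') by exists P'; rewrite h.
move: w; rewrite bwf_cat => /andP[_ wt].
(* A second run, on [t] with nothing left over, identifies the braid of [t] and not only its
   permutation. *)
have [||| P2 [_ -> _ /esym/size0nil -> _]] := @peel0 n P' t [::] nc'; rewrite ?cats0 //.
by rewrite /bprod big_nil mulg1.
Qed.

Lemma noncrossing_uniq n P s : noncrossing n P -> bwf n s -> bperm n s = bperm n (chains P) -> size s = size (chains P) ->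
  bprod n s = bprod n (chains P).
Proof.
by move=> nc w e es; have [P' [_ -> _ _ _]] := @peel n P [::] s nc w e es; rewrite /bprod big_nil mul1g.
Qed.

(** * Hurwitz moves and factors of delta *)

(** A conjugate of a transposition is a transposition, and fixing the dummy point keeps its indices
    in [1..n]. This is what allows factors to change places without a change of length. *)
Lemma bperm_conj n s (g : {perm 'I_n.+1}) : bwf n s -> g (inord 0) = inord 0 ->
  exists s', [/\ bwf n s', size s' = size s & bperm n s' = bperm n s ^ g].
Proof.
move=> + g0; elim: s => [|[i j] s IH] /=.
  by exists [::]; split => //; rewrite /bperm !big_nil conj1g.
move=> /andP[hp /IH [s' [w e e2]]].
set x := g (inord i); set y := g (inord j).
have d : x != y :> nat.
  by rewrite -[_ == _]/(x == y) (inj_eq perm_inj) inord_eq; lia.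
have nz k : 0 < k <= n -> 0 < g (inord k).
  move=> hk; rewrite lt0n; apply/eqP => h.
  have : g (inord k) == g (inord 0) by rewrite g0 -val_eqE /= inordK // h.
  by rewrite (inj_eq perm_inj) inord_eq; lia.
have x0 : 0 < x by apply: nz; lia.
have y0 : 0 < y by apply: nz; lia.
have xn := ltn_ord x; have yn := ltn_ord y.
exists ((maxn x y, minn x y) :: s'); split; rewrite /= ?e //; first by rewrite w; lia.
rewrite !bperm_cons conjMg e2; congr (_ * _).
rewrite /transp tpermJ /= -/x -/y /maxn /minn.
by case: ltnP => _; rewrite !inord_val // tpermC.
Qed.

Lemma delta_chain n : cls n (delta n) = bprod n (chain (iota 1 n)).
Proof.
rewrite -cls_bword; congr cls; case: n => // n.
elim: n => // n IH.
have e : iota 1 n.+2 = iota 1 n ++ [:: n.+1; n.+2].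
  by have := iotaD 1 n 2; rewrite addn2 add1n.
have e' : iota 1 n.+1 = iota 1 n ++ [:: n.+1].
  by have := iotaD 1 n 1; rewrite addn1 add1n.
rewrite e chain_cat bword_cat -cats1 -e' -IH [chain _]/= /bword /= cats0 bandSn.
by rewrite /delta [n.+2.-1]/= e' rev_cat.
Qed.

Lemma noncrossing_full n : noncrossing n [:: iota 1 n].
Proof.
rewrite /noncrossing /blockok /= !andbT iota_ltn_sorted /=.
by apply/allP => x; rewrite mem_iota /=; lia.
Qed.

Lemma Pb1 T : chains [:: T] = chain T.
Proof. by rewrite /chains /= cats0. Qed.

(** [s] is a factor of [delta] with complement [t]. Only length and permutation are recorded: they
    suffice by [noncrossing_uniq], and they survive Hurwitz moves. *)
Definition reduced n (s t : seq (nat * nat)) :=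
  [/\ bwf n (s ++ t), size (s ++ t) = n.-1 & bperm n (s ++ t) = braid_perm (cls n (delta n))].

Lemma bwf_full n : bwf n (chain (iota 1 n)).
Proof. by have /andP[/= /andP[h _] _] := noncrossing_full n; exact: blockok_chain. Qed.

Lemma braid_perm_delta_chain n : braid_perm (cls n (delta n)) = bperm n (chain (iota 1 n)).
Proof. by rewrite delta_chain braid_perm_bprod // bwf_full. Qed.

Lemma reduced_bprod n s t : reduced n s t -> bprod n s * bprod n t = cls n (delta n).
Proof.
move=> [w es e]; rewrite -bprod_cat delta_chain -Pb1.
by apply: noncrossing_uniq; rewrite ?Pb1 ?size_chain ?size_iota -?braid_perm_delta_chain //; exact: noncrossing_full.
Qed.

Lemma pp0 n s : bwf n s -> bperm n s (inord 0) = inord 0.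
Proof. by move=> w; apply: bperm_fix => // p /(allP w) /=; lia. Qed.

Lemma pp0V n s : bwf n s -> (bperm n s)^-1 (inord 0) = inord 0.
Proof. by move=> w; rewrite -{1}(pp0 w) permK. Qed.

(** The prefix [x] moves to the right of [s] as its conjugate by the permutation of [s]. *)
Lemma reduced_mid n x s y : reduced n (x ++ s) y -> exists t, reduced n s t.
Proof.
move=> [w es e]; move: (w); rewrite !bwf_cat => /andP[/andP[wx ws] wy].
have [x' [wx' sx' px']] := bperm_conj wx (pp0 ws).
exists (x' ++ y); split; first by rewrite !bwf_cat ws wx' wy.
  by rewrite -es !size_cat sx'; lia.
by rewrite -e !bperm_cat px' mulgA -conjgC.
Qed.

Lemma reduced_sym n s t : reduced n s t -> exists x, reduced n x s.
Proof.
move=> [w es e]; move: (w); rewrite !bwf_cat => /andP[ws wt].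
have [t' [wt' st' pt']] := bperm_conj wt (pp0V ws).
exists t'; split; first by rewrite !bwf_cat ws wt'.
  by rewrite -es !size_cat st'; lia.
by rewrite -e !bperm_cat pt' -conjgCV.
Qed.

Lemma reduced_noncrossing n s t : reduced n s t ->
  exists P, [/\ noncrossing n P, bprod n s = bprod n (chains P) & size s = size (chains P)].
Proof.
case/reduced_sym=> x [w es e].
have [||P [nc _ h1 h2 _]] := @peel n [:: iota 1 n] x s (noncrossing_full n) w.
- by rewrite Pb1 e braid_perm_delta_chain.
- by rewrite Pb1 es size_chain size_iota.
by exists P.
Qed.

Lemma reduced_split n s t i j : reduced n s t -> 0 < j < i -> i <= n ->
  inord i \in porbit (bperm n s) (inord j) ->
  exists Q, [/\ noncrossing n Q, bprod n s = bgen n i j * bprod n (chains Q) & size s = (size (chains Q)).+1].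
Proof.
move=> rst ji hi; have [P [nc eP sP]] := reduced_noncrossing rst.
have [w _ _] := rst; move: w; rewrite bwf_cat => /andP[ws _].
rewrite -(braid_perm_bprod ws) eP braid_perm_bprod ?bwf_chains ?(proj1 (andP nc)) // => /(step nc ji hi).
by case=> Q [ncQ -> sQ _]; exists Q; rewrite sP.
Qed.

Lemma pos_bprod n (w : word) s : valid n w -> bwf n s -> cls n w = bprod n s -> pos n w.
Proof.
move=> vw ws e; exists s; split; first exact: ws.
by apply/cls_beq => //; [exact: valid_bword | rewrite cls_bword].
Qed.

Lemma posP n w : pos n w -> exists2 s, bwf n s & cls n w = bprod n s.
Proof. by move=> [s [ws /beq_cls e]]; exists s; rewrite // e cls_bword. Qed.

Lemma valid_delta n : valid n (delta n).
Proof. by apply/allP => l /mapP[k]; rewrite mem_rev mem_iota => h -> /=; lia. Qed.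

Lemma reduced_simple n s t : reduced n s t -> simple n (bword s).
Proof.
move=> rst; have [w _ _] := rst; move: w; rewrite bwf_cat => /andP[ws wt]; split.
  by exists s; split => //; exact: beq_refl.
apply: (pos_bprod (s := t)) => //.
  by rewrite valid_cat valid_winv valid_bword // valid_delta.
by rewrite cls_cat cls_winv cls_bword -(reduced_bprod rst) mulKg.
Qed.

(** Collecting the powers of [g] on the left conjugates every copy of [s] except the last, so [s]
    itself survives as a right factor. *)
Lemma bperm_expand n (g : {perm 'I_n.+1}) s (k : nat) : bwf n s -> g (inord 0) = inord 0 ->
  exists x, [/\ bwf n x, size x = (k * size s)%N
    & (g * bperm n s) ^+ k.+1 = g ^+ k.+1 * bperm n (x ++ s)].
Proof.
move=> ws g0; elim: k => [|k [x [wx sx e]]]; first by exists [::]; rewrite !expg1.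
have [|y [wy sy py]] := @bperm_conj n (x ++ s) g _ g0; first by rewrite bwf_cat wx ws.
exists y; split => //; first by rewrite sy size_cat sx; lia.
rewrite [LHS]expgSr e (bperm_cat n y) py [g ^+ k.+2]expgSr -mulgA.
by rewrite (mulgA (bperm n _)) (conjgC (bperm n _) g) !mulgA.
Qed.

(** * The permutations of delta and epsilon *)

Lemma cycle_pow (T : finType) (q : {perm T}) (f : nat -> T) m :
  (forall k, k < m -> q (f k) = f k.+1) -> q (f m) = f 0 ->
  forall k, k <= m -> (q ^+ m.+1) (f k) = f k.
Proof.
move=> h1 h2.
have h k : k <= m -> (q ^+ k) (f 0) = f k.
  elim: k => [|k IH] hk; first by rewrite expg0 perm1.
  by rewrite expgSr permM IH ?h1 // ltnW.
move=> k hk; rewrite -{1}(h k hk) -permM.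
have -> : q ^+ k * q ^+ m.+1 = q ^+ m.+1 * q ^+ k by rewrite -!expgnDr addnC.
by rewrite permM expgSr permM h // h2 h.
Qed.

Lemma wperm_img n w x : valid n w -> x <= n -> wperm n w (inord x) = inord (perm_img w x).
Proof.
elim: w x => [|[i b] w IH] x; first by rewrite /wperm big_nil perm1.
rewrite /wperm big_cons /= => /andP[hi vw] hx; rewrite hi permM -/(wperm n w).
rewrite -IH //; last by rewrite /swap_pt; do !case: ifP => _; lia.
congr (wperm n w _); rewrite /swap_pt.
have [->|n1] := eqVneq x i; first by rewrite tpermL.
have [->|n2] := eqVneq x i.+1; first by rewrite tpermR.
by rewrite tpermD // inord_eq; lia.
Qed.

Lemma perm_img_delta n x : perm_img (delta n.+1) x =
  if x == 0 then 0 else if x <= n then x.+1 else if x == n.+1 then 1%N else x.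
Proof.
elim: n x => [|n IH] x; first by rewrite /=; do !case: ifP; lia.
have e : delta n.+2 = (n.+1, true) :: delta n.+1.
  have h := iotaD 1 n 1; rewrite addn1 add1n in h.
  by rewrite /delta [n.+2.-1]/= h rev_cat.
have -> : perm_img (delta n.+2) x = perm_img (delta n.+1) (swap_pt n.+1 x) by rewrite e.
rewrite IH /swap_pt; have [->|h1] := eqVneq x n.+1.
  by do !case: ifP; lia.
have [->|h2] := eqVneq x n.+2; first by do !case: ifP; lia.
by do !case: ifP; lia.
Qed.

Section Delta.
Variable n : nat.
Hypothesis n0 : 0 < n.
Let c : {perm 'I_n.+1} := braid_perm (cls n (delta n)).

Lemma braid_perm_delta x : x <= n -> c (inord x) =
  inord (if x == 0 then 0 else if x < n then x.+1 else 1%N).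
Proof.
move=> hx; rewrite /c braid_perm_cls wperm_img ?valid_delta //.
have <- : n.-1.+1 = n by lia.
rewrite perm_img_delta; congr inord.
by do !case: ifP => ?; lia.
Qed.

Lemma braid_perm_delta0 : c (inord 0) = inord 0.
Proof. by rewrite braid_perm_delta. Qed.

Lemma braid_perm_deltaX d x : 0 < x -> x + d <= n -> (c ^+ d) (inord x) = inord (x + d).
Proof.
move=> x0; elim: d => [|d IH] h; first by rewrite expg0 perm1 addn0.
rewrite expgSr permM IH; last lia.
by rewrite braid_perm_delta; [do !case: ifP => ?; congr inord; lia | lia].
Qed.

Lemma braid_perm_delta_order : c ^+ n = 1.
Proof.
apply/permP => z; rewrite perm1 -[z]inord_val; case: (posnP z) => [->|z0].
  by apply: permX_fix; rewrite braid_perm_delta0.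
have zn := ltn_ord z.
have h k : k <= n.-1 -> (c ^+ n.-1.+1) (inord k.+1) = inord k.+1.
  move: k; apply: (cycle_pow (f := fun k => inord k.+1)) => [k hk|].
    by rewrite braid_perm_delta; [do !case: ifP => ?; congr inord; lia | lia].
  rewrite (_ : n.-1.+1 = n); last lia.
  by rewrite braid_perm_delta //; do !case: ifP => ?; congr inord; lia.
have := h z.-1; rewrite (_ : z.-1.+1 = z); last lia.
by rewrite (_ : n.-1.+1 = n) => [->|] //; lia.
Qed.

(** [epsilon] fixes the strand 1 (and the dummy 0) and cycles the remaining [n-1] strands
    [2, ..., n]. *)
Lemma braid_perm_eps_order : 1 < n -> braid_perm (cls n (epsilon n)) ^+ n.-1 = 1.
Proof.
move=> n1; set q := braid_perm _.
have qE x : x <= n -> q (inord x) =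
    inord (if x <= 1 then x else if x < n then x.+1 else 2).
  move=> hx; rewrite /q cls_cat phiM permM -/c braid_perm_delta //.
  have vb : valid n (band 2 1) by apply: valid_band; lia.
  rewrite braid_perm_cls wperm_img //; last by do !case: ifP => ?; lia.
  rewrite bandSn /= /swap_pt; congr inord.
  have [->|x0] := eqVneq x 0; first by [].
  by have [xn|xn] := ltnP x n; do !case: ifP => ? //; lia.
apply/permP => z; rewrite perm1 -[z]inord_val; have zn := ltn_ord z.
have [z1|z1] := leqP z 1.
  by apply: permX_fix; rewrite qE ?z1 //; lia.
have h k : k <= n.-2 -> (q ^+ n.-2.+1) (inord k.+2) = inord k.+2.
  move: k; apply: (cycle_pow (f := fun k => inord k.+2)) => [k hk|].
    by rewrite qE; [do !case: ifP => ?; congr inord; lia | lia].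
  rewrite (_ : n.-2.+2 = n); last lia.
  by rewrite qE //; do !case: ifP => ?; congr inord; lia.
have := h z.-2; rewrite (_ : z.-2.+2 = z); last lia.
by rewrite (_ : n.-2.+1 = n.-1) => [->|] //; lia.
Qed.

End Delta.

(** * Words confined to an interval, and conjugation by powers of delta *)

Definition within a b (s : seq (nat * nat)) :=
  all (fun p => (a <= p.2)%N && (p.2 < p.1)%N && (p.1 <= b)%N) s.
Definition shift v (s : seq (nat * nat)) : seq (nat * nat) := [seq (p.1 + v, p.2 + v) | p <- s].

Lemma within_cat a b s t : within a b (s ++ t) = within a b s && within a b t.
Proof. exact: all_cat. Qed.

Lemma within_flatten a b ss : within a b (flatten ss) = all (within a b) ss.
Proof. by elim: ss => //= s ss <-; rewrite within_cat. Qed.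

Lemma within_le a b a' b' s : a' <= a -> b <= b' -> within a b s -> within a' b' s.
Proof. by move=> ha hb; apply: sub_all => p; lia. Qed.

Lemma within_bwf a b n s : 0 < a -> b <= n -> within a b s -> bwf n s.
Proof. exact: within_le. Qed.

Lemma within_shift a b a' b' v s : a' <= a + v -> b + v <= b' -> within a b s -> within a' b' (shift v s).
Proof.
by move=> ha hb /allP h; apply/allP => _ /mapP[p /h /= hp ->] /=; lia.
Qed.

Lemma shift_cat v s t : shift v (s ++ t) = shift v s ++ shift v t.
Proof. exact: map_cat. Qed.

Lemma up0 s : shift 0 s = s.
Proof. by rewrite /shift -[RHS]map_id; apply: eq_map => -[i j] /=; rewrite !addn0. Qed.

Lemma shift_shift v v' s : shift v (shift v' s) = shift (v' + v) s.
Proof. by rewrite /shift -map_comp; apply: eq_map => -[i j] /=; rewrite !addnA. Qed.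

Lemma shift_flatten v ss : shift v (flatten ss) = flatten [seq shift v s | s <- ss].
Proof. by rewrite /shift map_flatten. Qed.

Lemma shift_chain v T : shift v (chain T) = chain [seq x + v | x <- T].
Proof.
elim: T => [|x [|y T] IH] //.
by rewrite map_cons map_cons chain_cons shift_cat chain_cons IH map_cons.
Qed.

Lemma shift_chain_iota v a m : shift v (chain (iota a m)) = chain (iota (a + v) m).
Proof.
rewrite shift_chain; congr chain; rewrite [in RHS]addnC iotaDl.
by apply: eq_map => x; rewrite addnC.
Qed.

Lemma within_chain_iota a m : within a (a + m).-1 (chain (iota a m)).
Proof.
apply/allP => p /(mem_chain (iota_ltn_sorted _ _)) [].
by rewrite !mem_iota /=; lia.
Qed.

Lemma sep_comm n s t a b c e : 0 < a -> b < c -> e <= n -> within a b s -> within c e t ->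
  commute (bprod n s) (bprod n t).
Proof.
move=> a0 bc en /allP hs /allP ht; apply: commute_bprod2 => p q /hs /= hp /ht /= hq.
by apply: bgen_sep; lia.
Qed.

Section DeltaConj.
Variable n : nat.
Local Notation delt := (cls n (delta n)).

Lemma bgen_delta i j : 0 < j < i -> i < n -> bgen n i j ^ delt = bgen n i.+1 j.+1.
Proof.
case/andP=> j0; elim: i => // i IH; rewrite ltnS leq_eqVlt => /orP[/eqP <-|ji] hn.
  by rewrite !bdSn /conjg sigma_delta // mulKg.
rewrite bdS // conjJg conjVg IH; try lia.
rewrite [RHS]bdS; last lia.
by congr (_ ^ _^-1); rewrite /conjg sigma_delta ?mulKg //; lia.
Qed.

Lemma bprod_shift v s : bwf n s -> bwf n (shift v s) -> bprod n s ^ (delt ^+ v) = bprod n (shift v s).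
Proof.
move=> w1 w2; rewrite /bprod conjg_prod /shift big_map big_seq [RHS]big_seq.
apply: eq_bigr => p ps; have /= h1 := allP w1 _ ps.
have /= h2 := allP w2 _ (map_f (fun p => (p.1 + v, p.2 + v)) ps).
move: p {ps} h1 h2 => [i j] /= h1 h2.
elim: v {w2} h2 => [|v IH] h2; first by rewrite expg0 conjg1 !addn0.
by rewrite expgSr conjgM IH ?bgen_delta ?addnS //; lia.
Qed.

Lemma cls_tau v s : bwf n s -> bwf n (shift v s) ->
  cls n (tau n (- (Posz v))%R (bword (shift v s))) = bprod n s.
Proof.
move=> w1 w2; rewrite /tau GRing.opprK !cls_cat cls_wpow_nat cls_wpow_neg cls_bword.
by rewrite -bprod_shift // /conjg !mulgA mulgV mul1g mulgK.
Qed.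

Lemma chain_iotaS k : chain (iota 1 k.+2) = (k.+2, k.+1) :: chain (iota 1 k.+1).
Proof.
have e : iota 1 k.+2 = iota 1 k ++ [:: k.+1; k.+2].
  by have := iotaD 1 k 2; rewrite addn2 add1n.
have e' : iota 1 k.+1 = iota 1 k ++ [:: k.+1].
  by have := iotaD 1 k 1; rewrite addn1 add1n.
by rewrite e chain_cat e' cats1.
Qed.

(** Each new [a_{21}] passes the power of [delta] on its right and becomes [a_{k+2,k+1}], the next
    chord of the chain. *)
Lemma epsX k : k < n -> cls n (epsilon n) ^+ k = delt ^+ k * bprod n (chain (iota 1 k.+1)).
Proof.
elim: k => [|k IH] hk; first by rewrite !expg0 mul1g /bprod big_nil.
rewrite expgS IH; last lia.
rewrite cls_cat -/(bgen n 2 1) chain_iotaS bprod_cons /=.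
have : bgen n 2 1 ^ (delt ^+ k) = bgen n k.+2 k.+1.
  have := @bprod_shift k [:: (2, 1%N)]; rewrite /bprod /= !big_seq1 /= add2n add1n; apply; lia.
by move=> <-; rewrite -!mulgA (mulgA (bgen n 2 1)) (conjgC (bgen n 2 1)) !mulgA -expgS mulgVK.
Qed.

(** [[n, ..., 1] = [n, ..., k] [k, ..., 1]], and [reduced_mid] moves the first factor to the
    right. *)
Lemma reduced_low k : 0 < k <= n -> exists t, reduced n (chain (iota 1 k)) t.
Proof.
move=> hk; have k1 : (1 + k.-1)%N = k by lia.
have e : iota 1 n = iota 1 k.-1 ++ k :: iota k.+1 (n - k).
  have := iotaD 1 k.-1 (n - k).+1; rewrite k1.
  by have -> : (k.-1 + (n - k).+1)%N = n by lia.
have e' : rcons (iota 1 k.-1) k = iota 1 k.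
  have := iotaD 1 k.-1 1; rewrite k1; have -> : (k.-1 + 1)%N = k by lia.
  by move=> ->; rewrite cats1.
apply: (@reduced_mid n (chain (k :: iota k.+1 (n - k))) _ [::]).
rewrite -e' /reduced cats0 -chain_cat -e bwf_full braid_perm_delta_chain size_chain size_iota.
by split.
Qed.

End DeltaConj.

(** * The exponent sum *)

Section ExponentSum.
Import GRing.Theory Num.Theory.
Local Open Scope ring_scope.

Definition word_exponent n (w : word) : int := \sum_(l <- w | (0 < l.1 < n)%N) (if l.2 then 1 else -1).

Lemma word_exponent_cat n u v : word_exponent n (u ++ v) = word_exponent n u + word_exponent n v.
Proof. exact: big_cat. Qed.

Lemma word_exponent_beq n u v : beq n u v -> word_exponent n u = word_exponent n v.
Proof.
elim=> {u v} [u v l r|//|w1 w2 _ ->//|w1 w2 w3 _ -> _ ->//].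
move=> lr; rewrite !word_exponent_cat; congr (_ + (_ + _)).
case: lr => [i b hi|i j b c hi hj hij|i hi hin]; rewrite /word_exponent !big_cons big_nil /=.
- by rewrite hi; case: b.
- by rewrite hi hj; lia.
- by rewrite hi hin (ltn_trans _ hin).
Qed.

Definition exponent n (x : braid n) : int := word_exponent n (generic_quotient.repr x).

Lemma exponent_cls n w : exponent (cls n w) = word_exponent n w.
Proof.
have /clsP/asboolP/word_exponent_beq := cls_repr (cls n w).
have h u : word_exponent n (clean n u) = word_exponent n u.
  by rewrite /word_exponent /clean big_filter_cond; apply: eq_bigl => l; rewrite andbb.
by rewrite !h.
Qed.

Lemma chiM n (x y : braid n) : exponent (x * y)%g = exponent x + exponent y.
Proof. by rewrite -(cls_repr x) -(cls_repr y) -cls_cat !exponent_cls word_exponent_cat. Qed.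

Lemma chi1 n : @exponent n 1%g = 0.
Proof. by rewrite -cls_nil exponent_cls /word_exponent big_nil. Qed.

Lemma chiV n (x : braid n) : exponent (x^-1)%g = - exponent x.
Proof. by apply/eqP; rewrite -addr_eq0 -chiM mulVg chi1. Qed.

Lemma chiX n (x : braid n) k : exponent (x ^+ k)%g = k%:Z * exponent x.
Proof.
elim: k => [|k IH]; first by rewrite expg0 chi1 mul0r.
by rewrite expgS chiM IH; lia.
Qed.

Lemma exponent_wpow n w (k : int) : exponent (cls n (wpow w k)) = k * exponent (cls n w).
Proof.
case: k => k; first by rewrite cls_wpow_nat chiX.
by rewrite NegzE cls_wpow_neg chiV chiX mulNr.
Qed.

Lemma exponent_bprod n s : bwf n s -> exponent (bprod n s) = (size s)%:Z.
Proof.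
elim: s => [|[i j] s IH] /=; first by rewrite /bprod big_nil chi1.
move=> /andP[hp /IH hs]; rewrite bprod_cons chiM hs /=.
suff -> : exponent (bgen n i j) = 1 by lia.
have ji : (j < i)%N by lia.
elim: i ji hp => // i IHi; rewrite ltnS leq_eqVlt => /orP[/eqP <-|ji] hp.
  by rewrite bdSn exponent_cls /word_exponent big_cons big_nil /= addr0; case: ifP => //; lia.
rewrite bdS // /conjg !chiM IHi //; last lia.
by rewrite addrA chiV; lia.
Qed.

Lemma exponent_delta n : exponent (cls n (delta n)) = n.-1%:Z.
Proof. by rewrite delta_chain exponent_bprod ?bwf_full // size_chain size_iota. Qed.

End ExponentSum.

(** * The shape of super summit elements *)

Section SuperSummit.
Local Open Scope ring_scope.
Import Order.TTheory GRing.Theory Num.Theory.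

Lemma prec_exponent n u v : valid n u -> valid n v -> prec n u v ->
  exists s, [/\ bwf n s, ((cls n u)^-1 * cls n v)%g = bprod n s
     & exponent (cls n v) = exponent (cls n u) + (size s)%:Z].
Proof.
move=> vu vv /posP[s ws e]; exists s; rewrite -(exponent_bprod ws) -e cls_cat cls_winv; split => //.
by rewrite chiM chiV addrA subrr add0r.
Qed.

Lemma valid_wpow n w k : valid n w -> valid n (wpow w k).
Proof.
by move=> vw; case: k => k; rewrite /= ?valid_cat valid_flatten all_nseq ?valid_winv vw ?orbT.
Qed.

Lemma valid_epsilon n : (1 < n)%N -> valid n (epsilon n).
Proof. by move=> n1; rewrite valid_cat valid_delta valid_band. Qed.

Lemma exponent_epsilon n : (1 < n)%N -> exponent (cls n (epsilon n)) = n%:Z.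
Proof.
move=> n1; rewrite cls_cat chiM exponent_delta.
have /= := @exponent_bprod n [:: (2, 1)%N]; rewrite /bprod big_seq1 /= n1 => -> //.
by lia.
Qed.

(** [epsilon^d = delta^d [d+1, ..., 1]] with a simple second factor, which bounds inf below and sup
    above. Optimality holds because the exponent [dn] lies strictly between [d(n-1)] and
    [(d+1)(n-1)]. *)
Lemma len_epsX n d : (0 < d)%N -> (d < n.-1)%N -> len_is n (wpow (epsilon n) d%:Z) 1.
Proof.
move=> d0 dn; have n1 : (1 < n)%N by lia.
have vD k : valid n (wpow (delta n) k) by apply/valid_wpow/valid_delta.
have vE : valid n (wpow (epsilon n) d%:Z) by apply/valid_wpow/valid_epsilon.
have cE : cls n (wpow (epsilon n) d%:Z) = (cls n (delta n) ^+ d * bprod n (chain (iota 1 d.+1)))%g.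
  by rewrite cls_wpow_nat epsX //; lia.
have hE : exponent (cls n (wpow (epsilon n) d%:Z)) = d%:Z * n%:Z.
  by rewrite exponent_wpow exponent_epsilon.
have [|t red] := @reduced_low n d.+1; first by lia.
have [w _ _] := red; move: w; rewrite bwf_cat => /andP[wA wt].
exists d%:Z, (d.+1)%:Z; split; last split; last by lia.
- split.
    apply: (pos_bprod (s := chain (iota 1 d.+1))) => //.
      by rewrite valid_cat valid_winv vD vE.
    by rewrite cls_cat cls_winv cE cls_wpow_nat mulKg.
  move=> r' /(prec_exponent (vD _) vE) [s [_ _]]; rewrite hE exponent_wpow exponent_delta => e.
  by rewrite leNgt; apply/negP => h; nia.
- split.
    apply: (pos_bprod (s := t)) => //.
      by rewrite valid_cat valid_winv vD vE.
    rewrite cls_cat cls_winv cE cls_wpow_nat invgM expgSr -(reduced_bprod red).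
    by rewrite -!mulgA !mulKg.
  move=> s' /(prec_exponent vE (vD _)) [s [_ _]]; rewrite hE exponent_wpow exponent_delta => e.
  by rewrite leNgt; apply/negP => h; nia.
Qed.

Lemma SSS_form n d alpha : (0 < d)%N -> (d < n.-1)%N -> valid n alpha ->
  in_SSS n (wpow (epsilon n) d%:Z) alpha ->
  exists s t, [/\ reduced n s t, size s = d,
    cls n alpha = (cls n (delta n) ^+ d * bprod n s)%g
  & exists x, cls n alpha = (cls n (epsilon n) ^+ d ^ x)%g].
Proof.
move=> d0 dn va [_ [[x [vx /beq_cls ex]] [l [[r0 [s0 [[inf1 _] [[sup1 _] el]]]] lmin]]]].
have vD k : valid n (wpow (delta n) k) by apply/valid_wpow/valid_delta.
have n1 : (1 < n)%N by lia.
have vE : valid n (wpow (epsilon n) d%:Z) by apply/valid_wpow/valid_epsilon.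
have l1 : l <= 1.
  apply: (lmin _ 1 vE); last exact: len_epsX.
  by exists (nil : word); split => //; rewrite cats0; exact: beq_refl.
have {}ex : cls n alpha = (cls n (epsilon n) ^+ d ^ cls n x)%g.
  by rewrite -ex (cls_cat _ (winv _)) (cls_cat _ (wpow _ _)) cls_winv cls_wpow_nat.
have ha : exponent (cls n alpha) = d%:Z * n%:Z.
  by rewrite ex /conjg !chiM chiV chiX exponent_epsilon // addrCA addNr addr0.
have [s [ws es]] := prec_exponent (vD _) va inf1; rewrite ha exponent_wpow exponent_delta => cs.
have [t [wt et]] := prec_exponent va (vD _) sup1; rewrite ha exponent_wpow exponent_delta => ct.
(* The exponents give [r0 (n-1) <= dn <= s0 (n-1)]; as [d < n-1] this means [r0 <= d] and
   [d+1 <= s0], and [s0 - r0 <= 1] forces equality in both. *)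
have hr : r0 <= d%:Z by rewrite leNgt; apply/negP => h; nia.
have hs : (d.+1)%:Z <= s0 by rewrite leNgt; apply/negP => h; nia.
have {}hr : r0 = d%:Z by lia.
have {}hs : s0 = (d.+1)%:Z by lia.
subst r0 s0; rewrite cls_wpow_nat in es; rewrite cls_wpow_nat in et.
exists s, t; split; last by exists (cls n x).
- split; first by rewrite bwf_cat ws.
    by rewrite size_cat; nia.
  rewrite -braid_perm_bprod ?bwf_cat ?ws // bprod_cat -es -et expgSr; congr braid_perm.
  by rewrite !mulgA mulgK mulVg mul1g.
- by nia.
- by rewrite -es mulVKg.
Qed.

End SuperSummit.

(** * Grouping the blocks of a noncrossing partition *)

Lemma iota_sub r j : j < r -> iota j (r - j) = j :: iota j.+1 (r - j.+1).
Proof. by move=> h; rewrite (_ : r - j = (r - j.+1).+1) //; lia. Qed.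

Lemma noncrossing_filter n (a : pred (seq nat)) P : noncrossing n P -> noncrossing n (filter a P).
Proof.
move=> /andP[h1 h2]; rewrite /noncrossing pairwise_filter // andbT.
by apply/allP => T; rewrite mem_filter => /andP[_]; apply: (allP h1).
Qed.

Lemma chains_split n (a : pred (seq nat)) P : noncrossing n P ->
  bprod n (chains P) = bprod n (chains (filter a P)) * bprod n (chains (filter (predC a) P)) /\
  size (chains P) = (size (chains (filter a P)) + size (chains (filter (predC a) P)))%N.
Proof.
elim: P => [|T P IH] nc; first by rewrite /bprod big_nil mulg1.
have nc' : noncrossing n P by case/andP: nc => /= /andP[_ h] /andP[_ h']; apply/andP.
have [e es] := IH nc'; rewrite /=; case: ifP => aT /=; rewrite !chains_cons !bprod_cat !size_cat e es.
  by rewrite mulgA addnA.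
split; last by lia.
case/andP: (noncrossing_filter a nc'); rewrite !mulgA => bP _; congr (_ * _).
apply: chains_comm => //; first by case/andP: nc => /= /andP[].
apply/allP => U; rewrite mem_filter => /andP[_ UP].
by case/andP: nc => _ /= /andP[/allP/(_ _ UP)].
Qed.

(** Distinct blocks commute, so the product can be regrouped by any labelling [f] of the blocks. *)
Lemma chains_classes n (f : seq nat -> nat) r P : noncrossing n P -> all (fun T => f T < r) P ->
  let s := flatten [seq chains [seq T <- P | f T == k] | k <- iota 0 r] in
  bprod n (chains P) = bprod n s /\ size (chains P) = size s.
Proof.
elim: r P => [|r IH] P nc hP; first by case: P hP {nc}.
have e := iotaD 0 r 1; rewrite addn1 add0n in e.
move=> s; rewrite /s e map_cat flatten_cat /= cats0 bprod_cat size_cat.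
have [-> ->] := chains_split (fun T => f T < r) nc.
have [|e1 e2] := IH [seq T <- P | f T < r] (noncrossing_filter _ nc); first exact: filter_all.
have -> : [seq T <- P | f T == r] = filter (predC (fun T => f T < r)) P.
  by apply: eq_in_filter => T /(allP hP) /=; lia.
rewrite e1 e2 /=.
suff -> : [seq chains [seq T <- [seq T <- P | f T < r] | f T == k] | k <- iota 0 r] =
          [seq chains [seq T <- P | f T == k] | k <- iota 0 r] by [].
apply/eq_in_map => k; rewrite mem_iota => hk; rewrite -filter_predI; congr chains.
by apply: eq_filter => T /=; lia.
Qed.

Lemma chains_big P : chains [seq T <- P | 1 < size T] = chains P.
Proof.
elim: P => //= T P IH; case: ifP => hT; rewrite !chains_cons IH //.
by case: T hT => [|x []].
Qed.

Lemma iota_S a m : iota a m.+1 = a :: iota a.+1 m.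
Proof. by []. Qed.

(** * The rotated blocks and the conjugator *)

Section Blocks.
Variables r d n : nat.
Hypothesis r2 : 2 <= r.
Hypothesis d1 : 1 <= d.
Hypothesis nE : n = (r * d + 1)%N.

Definition dpow : {perm 'I_n.+1} := braid_perm (cls n (delta n)) ^+ d.
(* The permutation of [delta^d a_{d+1,1}]: it fixes 1 and rotates the r blocks
   {kd+2, ..., kd+d+1}. *)
Definition brot : {perm 'I_n.+1} := dpow * transp n (d.+1, 1%N).

Lemma dlt : d.+1 < n.
Proof. by rewrite nE; nia. Qed.

Lemma dpow0 : dpow (inord 0) = inord 0.
Proof. by rewrite /dpow permX_fix // braid_perm_delta0 //; lia. Qed.

Lemma brot0 : brot (inord 0) = inord 0.
Proof. by have ? := dlt; rewrite /brot permM dpow0 /transp /= tpermD // inord_eq; lia. Qed.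

Lemma brot_inord x : 2 <= x -> x <= r.-1 * d + 1 -> brot (inord x) = inord (x + d).
Proof.
move=> x2 xr; have ? := dlt; have xn : x + d <= n by rewrite nE; nia.
rewrite /brot permM /dpow braid_perm_deltaX; [|lia|lia|lia].
by rewrite /transp tpermD //= inord_eq; lia.
Qed.

Lemma brot_shift s : within 2 (r.-1 * d + 1) s -> bperm n s ^ brot = bperm n (shift d s).
Proof.
elim: s => [|[i j] s IH] /=; first by rewrite /bperm !big_nil conj1g.
move=> /andP[hp /IH e]; rewrite !bperm_cons conjMg e; congr (_ * _).
by rewrite /transp tpermJ /= !brot_inord //; lia.
Qed.

Definition blockrep (e : seq (nat * nat)) k := flatten [seq shift (i * d) e | i <- rev (iota 0 k)].

Lemma blockrepS e k : blockrep e k.+1 = shift d (blockrep e k) ++ e.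
Proof.
rewrite /blockrep shift_flatten iota_S rev_cons map_rcons -cats1 flatten_cat /= cats0 mul0n up0.
congr (_ ++ _); congr flatten.
rewrite -[1%N]addn0 iotaDl -map_rev -!map_comp.
by apply: eq_map => i /=; rewrite shift_shift mulnDl mul1n addnC.
Qed.

Lemma within_blockrep e k : within 2 d.+1 e -> within 2 (k * d + 1) (blockrep e k).
Proof.
move=> he; elim: k => // k IH; rewrite blockrepS within_cat; apply/andP; split.
  by apply: within_shift IH; lia.
by apply: within_le he; lia.
Qed.

Lemma brot_expand e k : within 2 d.+1 e -> k <= r ->
  (brot * bperm n e) ^+ k = brot ^+ k * bperm n (blockrep e k).
Proof.
move=> he; elim: k => [|k IH] hk; first by rewrite !expg0 /blockrep /bperm /= big_nil mulg1.
rewrite [LHS]expgSr IH ?(ltnW hk) // blockrepS bperm_cat -brot_shift; last first.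
  by apply: within_le (within_blockrep k he) => //; nia.
by rewrite [brot ^+ k.+1]expgSr -mulgA (mulgA (bperm n _)) (conjgC (bperm n _) brot) !mulgA.
Qed.

Lemma blockrep_low e k x : within 2 d.+1 e -> k < r -> x <= d.+1 ->
  bperm n (blockrep e k.+1) (inord x) = bperm n e (inord x).
Proof.
move=> he hk hx; have ? := dlt; rewrite blockrepS bperm_cat permM; congr (bperm n e _).
have hr := within_blockrep k he.
have hu : within (d + 2) n (shift d (blockrep e k)) by apply: within_shift hr; nia.
apply: bperm_fix; [by apply: within_bwf hu; lia | lia |].
by move=> p /(allP hu) /=; lia.
Qed.

(** After expansion both words give the same product over the [r] blocks, and on points up to [d+1]
    that product acts through its last factor alone. *)
Lemma brot_uniq e e' : within 2 d.+1 e -> within 2 d.+1 e' ->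
  (brot * bperm n e) ^+ r = 1 -> (brot * bperm n e') ^+ r = 1 -> bperm n e = bperm n e'.
Proof.
move=> he he' h h'; have ? := dlt.
have E : bperm n (blockrep e r) = bperm n (blockrep e' r).
  by apply: (mulgI (brot ^+ r)); rewrite -!brot_expand // h h'.
apply/permP => z; rewrite -[z]inord_val; have zn := ltn_ord z.
have [hz|hz] := leqP z d.+1.
  have rr : r.-1.+1 = r by lia.
  by rewrite -(blockrep_low (k := r.-1) he) ?rr -?(blockrep_low (k := r.-1) he') ?rr ?E //; lia.
have fx f : within 2 d.+1 f -> bperm n f (inord z) = inord z.
  move=> hf; apply: bperm_fix; [by apply: within_bwf hf; lia | lia |].
  by move=> p /(allP hf) /=; lia.
by rewrite !fx.
Qed.

(** Listed from the highest block down, to agree with [blockrep]. *)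
Definition blocks := [seq iota (i * d + 2) d | i <- rev (iota 0 r)].

Lemma chains_blocks : chains blocks = blockrep (chain (iota 2 d)) r.
Proof.
rewrite /chains /blocks /blockrep -map_comp; congr flatten; apply: eq_map => i /=.
by rewrite shift_chain_iota addnC.
Qed.

Lemma noncrossing_blocks : noncrossing n blocks.
Proof.
apply/andP; split.
  apply/allP => T /mapP[i]; rewrite mem_rev mem_iota => hi ->.
  rewrite /blockok iota_ltn_sorted; apply/allP => x; rewrite mem_iota /= nE; nia.
rewrite pairwise_map.
have : uniq (rev (iota 0 r)) by rewrite rev_uniq iota_uniq.
rewrite uniq_pairwise; apply: sub_pairwise => i j /= ij.
have : (i.+1 * d <= j * d) || (j.+1 * d <= i * d) by rewrite !leq_mul2r; lia.
rewrite !mulSn => h; apply/ndP; split=> [x|a b c e]; rewrite !mem_iota; first lia.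
by move=> *; lia.
Qed.

Lemma size_blockrep e k : size (blockrep e k) = (k * size e)%N.
Proof.
by elim: k => // k IH; rewrite blockrepS size_cat size_map IH mulSn addnC.
Qed.

Lemma size_blocks : size (chains blocks) = (r * d.-1)%N.
Proof. by rewrite chains_blocks size_blockrep size_chain size_iota. Qed.

Variable y : nat -> seq (nat * nat).
Hypothesis within_y : forall k, within 2 d.+1 (y k).

(* [crow j] stands for tau^{-jd}(b_j ... b_{r-1}) where b_k = tau^{kd}(y k), so
   [crows 1] is the conjugator c of the theorem. *)
Definition crow j := flatten [seq shift ((k - j) * d) (y k) | k <- iota j (r - j)].
Definition crows i := flatten [seq crow j | j <- iota i (r - i)].
Definition ytail i := flatten [seq y k | k <- iota i (r - i)].

Lemma crow_end j : r <= j -> crow j = [::].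
Proof. by move=> h; rewrite /crow (_ : r - j = 0) //; lia. Qed.

Lemma crows_end j : r <= j -> crows j = [::].
Proof. by move=> h; rewrite /crows (_ : r - j = 0) //; lia. Qed.

Lemma crowS j : j < r -> crow j = y j ++ shift d (crow j.+1).
Proof.
move=> hj; rewrite /crow iota_sub //= subnn mul0n up0 shift_flatten -map_comp.
congr (_ ++ flatten _); apply/eq_in_map => k; rewrite mem_iota => hk /=.
by rewrite shift_shift -mulSnr; congr (shift (_ * _) _); lia.
Qed.

Lemma crowsS i : crows i = crow i ++ crows i.+1.
Proof.
have [h|h] := ltnP i r; first by rewrite {1}/crows iota_sub.
by rewrite !crows_end ?crow_end //; lia.
Qed.

Lemma ytailS i : i < r -> ytail i = y i ++ ytail i.+1.
Proof. by move=> h; rewrite /ytail iota_sub. Qed.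

Lemma within_ytail i : within 2 d.+1 (ytail i).
Proof. by rewrite within_flatten all_map; apply/allP => k _ /=. Qed.

Lemma within_crow j : within 2 ((r - j) * d + 1) (crow j).
Proof.
rewrite within_flatten all_map; apply/allP => k; rewrite mem_iota => hk /=.
have [m em] : exists m, k = j + m by exists (k - j); lia.
have [p ep] : exists p, r - j = m + p.+1 by exists (r - k.+1); lia.
apply: within_shift (within_y k); first exact: leq_addr.
by rewrite ep em addKn mulnDl mulSn; lia.
Qed.

Lemma within_crows i : within 2 ((r - i) * d + 1) (crows i).
Proof.
rewrite within_flatten all_map; apply/allP => k; rewrite mem_iota => hk /=.
apply: within_le (within_crow k) => //.
by rewrite leq_add2r leq_mul2r; lia.
Qed.

Lemma within_shift_crow j : within (d + 2) n (shift d (crow j.+1)).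
Proof.
have [h|h] := ltnP j r; last by rewrite crow_end //; lia.
apply: within_shift (within_crow j.+1); first by lia.
have [p ep] : exists p, r = j.+1 + p by exists (r - j.+1); lia.
by rewrite nE ep addKn mulnDl mulSn; lia.
Qed.

Lemma within_shift_crows i : within (d + 2) n (shift d (crows i.+1)).
Proof.
have [h|h] := ltnP i r; last by rewrite crows_end //; lia.
apply: within_shift (within_crows i.+1); first by lia.
have [p ep] : exists p, r = i.+1 + p by exists (r - i.+1); lia.
by rewrite nE ep addKn mulnDl mulSn; lia.
Qed.

(** Since [crow i] is [y i] followed by the shift of [crow i.+1], it remains to move [ytail i.+1] to
    the left past that shift; their supports are separated. *)
Lemma crows_rec i : i <= r ->
  bprod n (crows i) = bprod n (ytail i) * bprod n (shift d (crows i.+1)) /\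
  size (crows i) = (size (ytail i) + size (crows i.+1))%N.
Proof.
move=> hi; have [m hm] := ubnP (r - i); elim: m i hi hm => // m IH i hi hm.
have [ir|ri] := ltnP i r; last first.
  have z : r - i = 0 by lia.
  by rewrite /ytail z !crows_end //= ?(leq_trans ri) // /bprod !big_nil mulg1.
have [|| e es] := IH i.+1; try lia.
split; last first.
  have es' : size (crows i.+1) = (size (crow i.+1) + size (crows i.+2))%N.
    by rewrite crowsS size_cat.
  by rewrite (crowsS i) (ytailS ir) (crowS ir) !size_cat size_map; lia.
rewrite (crowsS i) bprod_cat e (crowS ir) (ytailS ir) !bprod_cat (crowsS i.+1) shift_cat bprod_cat.
rewrite -!mulgA; congr (_ * _); rewrite !mulgA; congr (_ * _).
by apply/esym/sep_comm; [| | |exact: within_ytail|exact: within_shift_crow]; lia.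
Qed.

Local Notation delt := (cls n (delta n)).

Let ltdn : d.+1 < n := dlt.

Lemma bwf_low s : within 2 d.+1 s -> bwf n s.
Proof. by apply: within_bwf => //; exact: ltnW. Qed.

Lemma rngs_le i b : r - i <= b -> within 2 (b * d + 1) (crows i).
Proof.
move=> h; apply: within_le (within_crows i) => //.
by rewrite leq_add2r leq_mul2r h orbT.
Qed.

Lemma bwf_crows i : bwf n (crows i).
Proof. by apply: within_bwf (@rngs_le i r _); rewrite ?nE //; lia. Qed.

Lemma bwf_shift_crows i : bwf n (shift d (crows i.+1)).
Proof. by apply: within_bwf (within_shift_crows i); lia. Qed.

(** [crows i] is a right factor of the product of [r-i] shifted copies of [ytail 0], with lengths
    adding up. By [crows_rec] one copy contributes its right factor [ytail i], and the shifted
    copies contribute the shift of [crows i.+1]. *)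
Lemma crows_complete i : i <= r ->
  exists x, [/\ bwf n x, (size x + size (crows i) = (r - i) * size (ytail 0))%N
    & bperm n (x ++ crows i) = bperm n (blockrep (ytail 0) (r - i))].
Proof.
move=> hi; have [m hm] := ubnP (r - i); elim: m i hi hm => // m IH i hi hm.
have [ir|ri] := ltnP i r; last first.
  have z : r - i = 0 by lia.
  by exists [::]; rewrite crows_end // z.
have [|| x [wx sx px]] := IH i.+1; try lia.
have ri : r - i = (r - i.+1).+1 by lia.
have re := within_ytail 0.
pose pre := flatten [seq y k | k <- iota 0 i].
have ep : ytail 0 = pre ++ ytail i.
  rewrite /ytail /pre -flatten_cat -map_cat -[X in iota X (r - i)]add0n -iotaD.
  by congr (flatten (map _ (iota 0 _))); lia.
have wpre : bwf n pre.
  by move: (bwf_low re); rewrite ep bwf_cat => /andP[].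
have wt : bwf n (ytail i) by apply/bwf_low/within_ytail.
have hb k : r - k.+1 <= r.-1 by lia.
have [x1 [wx1 sx1 px1]] := bperm_conj wx brot0.
set U := bperm n (shift d (crows i.+1)).
have U0 : U^-1 (inord 0) = inord 0 by apply/pp0V/bwf_shift_crows.
have [p1 [wp1 sp1 pp1]] := bperm_conj wpre U0.
have [ec sc] := crows_rec hi.
exists (x1 ++ p1); split.
- by rewrite bwf_cat wx1.
- rewrite size_cat sx1 sp1 sc ri mulSn.
  have : size (ytail 0) = (size pre + size (ytail i))%N by rewrite ep size_cat.
  by move: sx; lia.
- rewrite ri blockrepS (bperm_cat n (shift d _)) -brot_shift; last first.
    apply: within_le (within_blockrep (r - i.+1) re) => //.
    by rewrite leq_add2r leq_mul2r hb orbT.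
  rewrite -px (bperm_cat n x) conjMg (brot_shift (rngs_le (hb i))) -/U.
  rewrite ep !bperm_cat -px1 pp1 -(braid_perm_bprod (bwf_crows i)) ec phiM (braid_perm_bprod wt) (braid_perm_bprod (bwf_shift_crows i)) -/U.
  have cU : bperm n (ytail i) * U = U * bperm n (ytail i).
    rewrite /U -(braid_perm_bprod wt) -(braid_perm_bprod (bwf_shift_crows i)) -!phiM; congr braid_perm.
    by apply: (@sep_comm n _ _ 2 d.+1 (d + 2) n) => //;
      [lia | exact: within_ytail | exact: within_shift_crows].
  by rewrite cU /conjg invgK !mulgA mulgVK.
Qed.

(** With [c] = [crows 1], [crow 0] times [c] equals [ytail 0] times the shift of [c] by [d]. The
    shift of [c] commutes with [a_{d+1,1}] and [ytail 0], and returns to [c] when it passes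
    [delta^d]. *)
Lemma conj_crows (a : braid n) : a = delt ^+ d * bgen n d.+1 1 * bprod n (crow 0) ->
  a ^ bprod n (crows 1) = delt ^+ d * bgen n d.+1 1 * bprod n (ytail 0).
Proof.
move=> ea; have e0 : bprod n (crow 0) * bprod n (crows 1) =
    bprod n (ytail 0) * bprod n (shift d (crows 1)).
  have [<- _] := @crows_rec 0 ltac:(lia).
  by rewrite (crowsS 0) bprod_cat.
set q := (d.+1, 1%N) :: ytail 0.
have cq : bprod n q * bprod n (shift d (crows 1)) = bprod n (shift d (crows 1)) * bprod n q.
  apply: (@sep_comm n _ _ 1 d.+1 (d + 2) n) => //; [lia | | exact: within_shift_crows].
  apply/andP; split; first by rewrite /=; lia.
  by apply: within_le (within_ytail 0).
have eq : bprod n q = bgen n d.+1 1 * bprod n (ytail 0) by rewrite bprod_cons.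
have h : a * bprod n (crows 1) = bprod n (crows 1) * (delt ^+ d * bprod n q).
  rewrite ea -mulgA e0 mulgA -(mulgA _ (bgen n _ _)) -eq -mulgA cq.
  by rewrite -bprod_shift ?bwf_crows ?bwf_shift_crows // mulgA -conjgC mulgA.
by rewrite /conjg h mulKg eq mulgA.
Qed.

(* The r conjugates of [a_{d+1,1}] in the expansion of [brot ^+ r] complete the
   product over all the blocks to a factorization of delta. *)
Lemma reduced_crows : size (ytail 0) = d.-1 -> (brot * bperm n (ytail 0)) ^+ r = 1 ->
  exists x t, reduced n (x ++ crows 0) t.
Proof.
move=> sy br; have n0 : 0 < n by lia.
have re := within_ytail 0.
have [x [wx sx px]] := @crows_complete 0 ltac:(lia).
have wt : bwf n [:: (d.+1, 1%N)] by rewrite /=; lia.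
have [z [wz sz ez]] := bperm_expand r.-1 wt dpow0.
have hz : bperm n (z ++ [:: (d.+1, 1%N)]) = (dpow ^+ r)^-1 * brot ^+ r.
  rewrite (_ : r.-1.+1 = r) in ez; last lia.
  rewrite -(mulKg (dpow ^+ r) (bperm n _)) -ez; congr (_ * (_ * _) ^+ _).
  by rewrite /bperm big_seq1.
have hb : brot ^+ r * bperm n (blockrep (ytail 0) r) = 1 by rewrite -brot_expand.
exists ((z ++ [:: (d.+1, 1%N)]) ++ x), [::]; rewrite /reduced cats0; split.
- by rewrite !bwf_cat wz wx bwf_crows wt.
- rewrite -catA size_cat (size_cat x) sx sy subn0 size_cat sz /= nE; nia.
rewrite -catA bperm_cat px hz subn0 -mulgA hb mulg1; apply/mulg1_eq.
by rewrite /dpow -expgnA -expgSr (_ : (d * r).+1 = n) ?braid_perm_delta_order //; lia.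
Qed.

End Blocks.

(** * Factorization along the blocks *)

Lemma bword_flatten ss : bword (flatten ss) = flatten [seq bword s | s <- ss].
Proof. by elim: ss => //= s ss <-; rewrite bword_cat. Qed.

Lemma bprod_flatten n ss : bprod n (flatten ss) = \prod_(s <- ss) bprod n s.
Proof.
by elim: ss => [|s ss IH] /=; rewrite ?big_cons -?IH ?bprod_cat // big_nil /bprod big_nil.
Qed.

Lemma size_shift v s : size (shift v s) = size s.
Proof. exact: size_map. Qed.

Lemma size_crow0 r d y : size (crow r d y 0) = size (ytail r y 0).
Proof.
rewrite /crow /ytail !size_flatten /shape -!map_comp; congr sumn.
by apply: eq_map => k /=; rewrite size_shift.
Qed.

Lemma within_hook d : 0 < d -> within 2 d.+1 (chain (iota 2 d)).
Proof. by move=> d0; apply: within_le (within_chain_iota 2 d). Qed.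

Lemma hook_split n d : 0 < d < n ->
  bprod n (chain (iota 1 d.+1)) = bgen n d.+1 1 * bprod n (chain (iota 2 d)).
Proof.
case: d => // d hd.
have e : iota 2 d.+1 = rcons (iota 2 d) d.+2.
  by have := iotaD 2 d 1; rewrite addn1 cats1 add2n.
have p := iota_ltn_sorted 1 d.+2.
by rewrite iota_S e hook_low -?e //; lia.
Qed.

Lemma braid_perm_brot d n s : 0 < d < n -> bwf n s ->
  braid_perm (cls n (delta n) ^+ d * bgen n d.+1 1 * bprod n s) = brot d n * bperm n s.
Proof. by move=> hd ws; rewrite !phiM phiX braid_perm_bprod // braid_perm_bgen //; lia. Qed.

(** Both hypotheses on [r]-th powers expand over [brot ^+ r]. Comparing them makes [chains Q] a
    right factor of a word of length [r(d-1)] for the product over the blocks, so peeling refines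
    the blocks. *)
Lemma block_decomposition r d n Q : 2 <= r -> 1 <= d -> n = (r * d + 1)%N ->
  noncrossing n Q -> size (chains Q) = d.-1 -> (brot d n * bperm n (chains Q)) ^+ r = 1 ->
  (brot d n * bperm n (chain (iota 2 d))) ^+ r = 1 ->
  exists (B : nat -> seq (seq nat)) (y : nat -> seq (nat * nat)),
  [/\ forall k, noncrossing n (B k) &&
        all (fun T => (1 < size T) && all (fun x => x \in iota (k * d + 2) d) T) (B k),
      forall k, within 2 d.+1 (y k), forall k, shift (k * d) (y k) = chains (B k),
      bprod n (chains Q) = bprod n (crow r d y 0) & size (crow r d y 0) = d.-1].
Proof.
move=> r2 d1 nE ncQ sQ hQ hD.
have wQ := bwf_chains (proj1 (andP ncQ)).
have [x [wx sx ex]] := bperm_expand r.-1 wQ (brot0 r2 d1 nE).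
rewrite (_ : r.-1.+1 = r) in ex; last lia.
have [||| P [nc _ eP sP rP]] := @peel n (blocks r d) x (chains Q) (noncrossing_blocks r2 d1 nE).
- by rewrite bwf_cat wx.
- rewrite chains_blocks; apply: (mulgI (brot d n ^+ r)).
  by rewrite -ex hQ -(brot_expand r2 d1 nE) ?within_hook // hD.
- by rewrite size_cat sx size_blocks sQ; nia.
(* Peeling may leave singletons, while [supported_on] lists only blocks with at least two points. *)
pose P3 := [seq T <- P | 1 < size T].
have nc3 : noncrossing n P3 by exact: noncrossing_filter.
(* The index of the block containing [T], read off its first point; the default 2 is never reached,
   as members of [P3] are nonempty. *)
pose f (T : seq nat) := (head 2 T - 2) %/ d.
have hf T : T \in P3 -> f T < r /\ forall x, x \in T -> f T * d + 2 <= x < f T * d + 2 + d.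
  rewrite mem_filter => /andP[s1 /rP [_ /mapP[i + ->] sub]].
  rewrite mem_rev mem_iota => hi.
  have fi : f T = i.
    rewrite /f; case: (T) s1 sub => // a T' _ /(_ a (mem_head _ _)).
    rewrite mem_iota /= => ha.
    have -> : a - 2 = (i * d + (a - 2 - i * d))%N by lia.
    by rewrite divnMDl // divn_small ?addn0 //; lia.
  by rewrite fi; split; [lia | move=> z /sub; rewrite mem_iota].
pose B k := [seq T <- P3 | f T == k].
have hB k : noncrossing n (B k) &&
    all (fun T => (1 < size T) && all (fun x => x \in iota (k * d + 2) d) T) (B k).
  rewrite noncrossing_filter //=; apply/allP => T; rewrite mem_filter => /andP[/eqP fT TP].
  have [_ h] := hf T TP; move: TP; rewrite mem_filter => /andP[-> _] /=.
  by apply/allP => z /h; rewrite fT mem_iota.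
have rB k : within (k * d + 2) (k * d + d.+1) (chains (B k)).
  have /andP[ncB /allP aB] := hB k.
  apply/allP => p /mem_chains[T TB pT]; have /andP[_ /allP aT] := aB T TB.
  have /andP[sT _] := allP (proj1 (andP ncB)) T TB.
  by have [/aT + /aT + bperm] := mem_chain sT pT; rewrite !mem_iota; lia.
(* The subtractions are exact, since all indices in [B k] are at least [kd+2]. *)
pose y k := [seq (p.1 - k * d, p.2 - k * d) | p <- chains (B k)] : seq (nat * nat).
have uy k : shift (k * d) (y k) = chains (B k).
  rewrite /shift /y -map_comp -[RHS]map_id; apply/eq_in_map => -[i j] /(allP (rB k)) /= h.
  by congr (_, _); lia.
have c0 : crow r d y 0 = flatten [seq chains (B k) | k <- iota 0 r].
  by rewrite /crow subn0; congr flatten; apply: eq_map => k; rewrite subn0 uy.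
have [|e1 e2] := chains_classes (f := f) (r := r) nc3.
  by apply/allP => T /hf[].
exists B, y; split => //.
- by move=> k; apply/allP => _ /mapP[p /(allP (rB k)) /= h ->] /=; lia.
- by rewrite c0 eP -(chains_big P) e1.
- by rewrite c0 -e2 chains_big -sP sQ.
Qed.

(** [brot_uniq] gives equality of permutations; both words have length [d-1], so the braids agree as
    well. *)
Lemma tail_hook r d n y : 2 <= r -> 1 <= d -> n = (r * d + 1)%N -> (forall k, within 2 d.+1 (y k)) ->
  size (ytail r y 0) = d.-1 -> (brot d n * bperm n (ytail r y 0)) ^+ r = 1 ->
  (brot d n * bperm n (chain (iota 2 d))) ^+ r = 1 ->
  bprod n (ytail r y 0) = bprod n (chain (iota 2 d)).
Proof.
move=> r2 d1 nE ry sy h1 h2; have ? := dlt r2 d1 nE; rewrite -[chain _]Pb1.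
apply: noncrossing_uniq; rewrite ?Pb1 ?size_chain ?size_iota //.
- rewrite /noncrossing /blockok /= iota_ltn_sorted !andbT.
  by apply/allP => z; rewrite mem_iota /=; lia.
- by apply: within_bwf (within_ytail r ry 0); lia.
- by apply: (brot_uniq r2 d1 nE) => //; [exact: within_ytail | exact: within_hook].
Qed.

Lemma simple_bprod n w s t : reduced n s t -> valid n w -> cls n w = bprod n s -> simple n w.
Proof.
move=> red vw e; have [ws _ _] := red; move: ws; rewrite bwf_cat => /andP[ws wt]; split.
  exact: (pos_bprod (s := s)).
apply: (pos_bprod (s := t)) => //; first by rewrite valid_cat valid_winv vw valid_delta.
by rewrite cls_cat cls_winv e -(reduced_bprod red) mulKg.
Qed.

(** * Pure elements of the super summit set *)

Section Main.
Variables (r d n : nat) (alpha : word).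
Hypothesis r2 : 2 <= r.
Hypothesis d1 : 1 <= d.
Hypothesis nE : n = (r * d + 1)%N.
Hypothesis va : valid n alpha.
Hypothesis pure : one_pure alpha.
Hypothesis sss : in_SSS n (wpow (epsilon n) (Posz d)) alpha.
Local Notation delt := (cls n (delta n)).

(** [delta^d] sends 1 to [d+1] and [alpha] fixes 1, so the simple factor sends [d+1] back to 1.
    These two points share a cycle, and [a_{d+1,1}] can be pulled out on the left. *)
Lemma pure_factor : exists s t Q, [/\ reduced n s t, size s = d,
  cls n alpha = delt ^+ d * bprod n s, noncrossing n Q
  & bprod n s = bgen n d.+1 1 * bprod n (chains Q) /\ size s = (size (chains Q)).+1].
Proof.
have dn := dlt r2 d1 nE.
have [||s [t [red ss ea _]]] := SSS_form _ _ va sss; try lia.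
have [ws _ _] := red; move: ws; rewrite bwf_cat => /andP[ws _].
have fix1 : braid_perm (cls n alpha) (inord 1) = inord 1.
  by rewrite braid_perm_cls wperm_img ?pure //; lia.
have hs : bperm n s (inord d.+1) = inord 1.
  move: fix1; rewrite ea phiM phiX permM braid_perm_bprod // braid_perm_deltaX ?add1n //; lia.
have ho : inord d.+1 \in porbit (bperm n s) (inord 1).
  by rewrite porbit_sym -[X in X \in _]hs -[bperm n s in X in X \in _]expg1; exact: mem_porbit.
have [||Q [ncQ e es]] := reduced_split red _ _ ho; try lia.
by exists s, t, Q.
Qed.

(** [b] is conjugate to [epsilon^d], and [dr = n-1] is a multiple of the order of the permutation of
    [epsilon]. *)
Lemma braid_perm_power b z : b = cls n alpha ^ z -> braid_perm b ^+ r = 1.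
Proof.
have dn := dlt r2 d1 nE.
have [||s [t [_ _ _ [x ex]]]] := SSS_form _ _ va sss; try lia.
move=> ->; rewrite ex -conjgM phiJ phiX -conjXg -expgnA.
rewrite (_ : (d * r)%N = n.-1); last by lia.
by rewrite braid_perm_eps_order ?conj1g //; lia.
Qed.

Lemma eps_factor : cls n (epsilon n) ^+ d = delt ^+ d * bgen n d.+1 1 * bprod n (chain (iota 2 d)).
Proof.
have dn := dlt r2 d1 nE.
by rewrite epsX ?hook_split ?mulgA //; lia.
Qed.

Lemma hook_power : (brot d n * bperm n (chain (iota 2 d))) ^+ r = 1.
Proof.
have dn := dlt r2 d1 nE.
rewrite -braid_perm_brot; [|lia|by apply: within_bwf (within_hook d1); lia].
rewrite -eps_factor; have [||s [t [_ _ _ [x ex]]]] := SSS_form _ _ va sss; try lia.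
by apply: (braid_perm_power (z := x^-1)); rewrite ex conjgK.
Qed.

End Main.

Local Close Scope group_scope.

Theorem theorem3p2 (r d n : nat) (alpha : word) :
  (2 <= r)%N -> (1 <= d)%N -> n = (r * d + 1)%N ->
  valid n alpha -> one_pure alpha ->
  in_SSS n (wpow (epsilon n) d%:Z) alpha ->
  (d = 1%N -> beq n alpha (epsilon n)) /\
  ((2 <= d)%N ->
   exists (a : word) (b : nat -> word),
     valid n a /\ (forall k, (k < r)%N -> valid n (b k)) /\
     simple n a /\
     beq n alpha (wpow (delta n) d%:Z ++ a) /\
     beq n a (band (d + 1) 1 ++ flatten [seq b k | k <- iota 0 r]) /\
     (forall k, (k < r)%N -> supported_on n (iota (k * d + 2) d) (b k)) /\
     beq n (flatten [seq tau n (- (k * d)%:Z)%R (b k) | k <- iota 0 r])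
           (subsimple (iota 2 d)) /\
     (let c := flatten [seq tau n (- (j * d)%:Z)%R
                              (flatten [seq b k | k <- iota j (r - j)])
                       | j <- iota 1 (r - 1)] in
      simple n c /\ beq n (winv c ++ alpha ++ c) (wpow (epsilon n) d%:Z))).
Proof.
move=> r2 d1 nE va pure sss.
have dn := dlt r2 d1 nE.
have [s [t [Q [red ss ea ncQ [es sQ]]]]] := pure_factor r2 d1 nE va pure sss.
have wQ := bwf_chains (proj1 (andP ncQ)).
have vdel k : valid n (wpow (delta n) k) by apply/valid_wpow/valid_delta.
have veps : valid n (epsilon n) by apply: valid_epsilon; lia.
split=> [de|d2].
  (* For [d = 1] the simple factor has a single letter, so it is [a_{21}]. *)
  apply/cls_beq => //; rewrite ea es (size0nil (s := chains Q)); last by lia.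
  by rewrite de /bprod big_nil mulg1 expg1 cls_cat.
have hQ : ((brot d n * bperm n (chains Q)) ^+ r = 1)%g.
  rewrite -braid_perm_brot //; last by lia.
  apply: (braid_perm_power r2 d1 nE va sss (z := 1%g)).
  by rewrite conjg1 ea es mulgA.
have hD := hook_power r2 d1 nE va sss.
have [|B [y [hB ry uy eQ sy]]] := block_decomposition r2 d1 nE ncQ _ hQ hD; first by lia.
have wC := bwf_crows r2 d1 nE ry; have wC0 := wC 0.
have tot : cls n alpha = (cls n (delta n) ^+ d * bgen n d.+1 1 * bprod n (crow r d y 0))%g.
  by rewrite ea es eQ mulgA.
have conj := conj_crows r2 d1 nE ry tot.
have st : size (ytail r y 0) = d.-1 by move: sy; rewrite size_crow0.
have wt : bwf n (ytail r y 0) by apply: within_bwf (within_ytail r ry 0); lia.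
have ht : ((brot d n * bperm n (ytail r y 0)) ^+ r = 1)%g.
  rewrite -braid_perm_brot //; last by lia.
  (* By [conj] this braid is the conjugate of [alpha] by [c]. *)
  by apply: (braid_perm_power r2 d1 nE va sss); exact/esym/conj.
have eD := tail_hook r2 d1 nE ry st ht hD.
have wcrow0 : bwf n (crow r d y 0).
  by move: wC0; rewrite (crowsS r2 d1 nE) bwf_cat => /andP[].
pose b k := bword (chains (B k)).
have wB k : bwf n (chains (B k)) by apply/bwf_chains; have /andP[/andP[]] := hB k.
have vb k : valid n (b k) by exact: valid_bword.
have vbs l : valid n (flatten [seq b k | k <- l]).
  by rewrite valid_flatten all_map; apply/allP => k _ /=.
have vband : valid n (band (d + 1) 1) by apply: valid_band; lia.
have upE j : shift (j * d) (crow r d y j) = flatten [seq chains (B k) | k <- iota j (r - j)].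
  rewrite /crow shift_flatten -map_comp; congr flatten; apply/eq_in_map => k.
  by rewrite mem_iota -uy => hk /=; rewrite shift_shift -mulnDl subnK //; lia.
have row j : flatten [seq b k | k <- iota j (r - j)] = bword (shift (j * d) (crow r d y j)).
  by rewrite upE bword_flatten -map_comp.
have wup j : bwf n (shift (j * d) (crow r d y j)).
  by rewrite upE [bwf _ _]within_flatten all_map; apply/allP => k _ /=; exact: wB.
have wrow j : bwf n (crow r d y j).
  apply: within_bwf (within_crow r2 d1 nE ry j) => //.
  by rewrite [leqRHS]nE leq_add2r leq_mul2r leq_subr orbT.
have cls_row j : cls n (tau n (- (Posz (j * d)))%R (flatten [seq b k | k <- iota j (r - j)])) =
    bprod n (crow r d y j).
  by rewrite row cls_tau.
have crow0E : flatten [seq b k | k <- iota 0 r] = bword (crow r d y 0).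
  by have := row 0; rewrite mul0n up0 subn0.
(* The complement [t] of [s] still serves, since the new word has the length and the permutation of
   [s]. *)
have redA : reduced n ((d.+1, 1) :: crow r d y 0) t.
  have [w sz e] := red; move: w; rewrite bwf_cat => /andP[ws wt'].
  have w' : bwf n ((d.+1, 1) :: crow r d y 0) by rewrite /= wcrow0; lia.
  split; first by rewrite bwf_cat w'.
    by rewrite -sz !size_cat /= sy; lia.
  rewrite -e !bperm_cat; congr (_ * _)%g; rewrite -!braid_perm_bprod //.
  by rewrite bprod_cons es eQ.
exists (band (d + 1) 1 ++ flatten [seq b k | k <- iota 0 r]), b.
have va' : valid n (band (d + 1) 1 ++ flatten [seq b k | k <- iota 0 r]).
  by rewrite valid_cat vband vbs.
have cA : cls n (band (d + 1) 1 ++ flatten [seq b k | k <- iota 0 r]) =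
          bprod n ((d.+1, 1) :: crow r d y 0).
  by rewrite cls_cat crow0E cls_bword bprod_cons addn1.
split=> //; split=> //; split; first exact: simple_bprod redA va' cA.
split.
  apply/cls_beq => //; first by rewrite valid_cat vdel.
  by rewrite cls_cat cls_wpow_nat cA tot bprod_cons mulgA.
split; first exact: beq_refl.
split=> [k hk|].
  have [ncB aB] := andP (hB k); split.
    have ei : iota 0 r = iota 0 k ++ k :: iota k.+1 (r - k.+1).
      by rewrite -iota_sub // -iotaD subnKC // ltnW.
    (* Each [b_k] is a middle factor of the word of [a], so it divides [delta] by [reduced_mid]. *)
    have e0 : (d.+1, 1) :: crow r d y 0 =
        (((d.+1, 1) :: flatten [seq chains (B i) | i <- iota 0 k]) ++ chains (B k)) ++
        flatten [seq chains (B i) | i <- iota k.+1 (r - k.+1)].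
      have := upE 0; rewrite mul0n up0 subn0 => ->.
      by rewrite ei map_cat flatten_cat /= -catA.
    have [u redu] : exists u, reduced n (chains (B k)) u.
      apply: (@reduced_mid n ((d.+1, 1) :: flatten [seq chains (B i) | i <- iota 0 k]) _
        (flatten [seq chains (B i) | i <- iota k.+1 (r - k.+1)] ++ t)).
      by rewrite /reduced catA -e0.
    exact: reduced_simple redu.
  exists (B k); split; last split; last by rewrite /b bword_chains; exact: beq_refl.
    apply/allP => T TB; have /andP[-> aT] := allP aB T TB.
    have /andP[-> iT] := allP (proj1 (andP ncB)) T TB.
    by apply/allP => z zT; rewrite (allP iT) // (allP aT).
  by case/andP: ncB.
have vtau v w : valid n w -> valid n (tau n (- (Posz v))%R w).
  by move=> vw; rewrite /tau !valid_cat !vdel vw.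
have vtaus (F : nat -> nat) (W : nat -> word) l : (forall k, valid n (W k)) ->
    valid n (flatten [seq tau n (- (Posz (F k)))%R (W k) | k <- l]).
  by move=> vW; rewrite valid_flatten all_map; apply/allP => k _ /=; apply/vtau/vW.
split.
  apply/cls_beq; first exact: vtaus.
    rewrite -bword_chain; apply/valid_bword/(within_bwf _ _ (within_hook d1)) => //.
    exact: ltnW.
  rewrite -bword_chain cls_bword -eD /ytail subn0 bprod_flatten cls_flatten !big_map.
  apply: eq_bigr => k _; rewrite /b -uy cls_tau // ?uy //.
  by apply: within_bwf (ry k) => //; exact: ltnW.
move=> c.
have vc : valid n c by apply: (vtaus (fun j => (j * d)%N)) => j; exact: vbs.
have cc : cls n c = bprod n (crows r d y 1).
  rewrite /c cls_flatten /crows bprod_flatten !big_map subn1.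
  by apply: eq_bigr => j _; rewrite cls_row.
split.
  (* [crows 0] is [crow 0] followed by the word of [c], so [c] inherits being a factor of
     [delta]. *)
  have [x [u redx]] := reduced_crows r2 d1 nE ry st ht.
  have [v redc] : exists v, reduced n (crows r d y 1) v.
    by apply: (@reduced_mid n (x ++ crow r d y 0) _ u); rewrite -catA -(crowsS r2 d1 nE).
  exact: simple_bprod redc vc cc.
apply/cls_beq; first by rewrite !valid_cat valid_winv vc va.
  exact: valid_wpow.
rewrite cls_cat (cls_cat _ alpha) cls_winv cc cls_wpow_nat.
rewrite (eps_factor r2 d1 nE va) -eD -conj.
by rewrite /conjg.
Qed.
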